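(* Let $(I,J)\oplus(A,B)$ be a canonical matrix pair for contragredient equivalence, in which $J$ is a nonsingular Jordan canonical matrix, $$(A,B)=\bigoplus_{i=1}^l(F_{p_i},G_{p_i}^T)\oplus(I,J(0))\oplus(J'(0),I)\oplus\bigoplus_{i=1}^r(G_{q_i}^T,F_{q_i}),$$ $J(0)$ and $J'(0)$ are Jordan matrices with the single eigenvalue $0$, and $$p_1\ge p_2\ge\dots\ge p_l,\qquad q_1\le q_2\le\dots\le q_r.$$ Then one of the simple miniversal deformations of $(I,J)\oplus(A,B)$ (with respect to contragredient equivalence) has the form $$(I,J+\mathcal K)\oplus(\mathcal A,\mathcal B),$$ in which $J+\mathcal K$ is the Arnold deformation of $J$ (see context) and $(\mathcal A,\mathcal B)$ is the following deformation of $(A,B)$: $$\mathcal A=\begin{bmatrix} \mathcal A_{11}&\mathcal H_{\vartriangle}&\mathcal H&\mathcal H \\ 0&I&\mathcal H&\mathcal H_{\rhd} \\ 0&0&J'(0)+\mathcal H&\mathcal H \\ 0&0&0&\mathcal A_{44} \end{bmatrix},\qquad \mathcal B=\begin{bmatrix} \mathcal B_{11}&0&0&0 \\ \mathcal H&J(0)+\mathcal H&0&0 \\ \mathcal H_{\rhd}&\mathcal H&I&0 \\ \mathcal H&\mathcal H&\mathcal H_{\vartriangle}&\mathcal B_{44} \end{bmatrix},$$ where $$\mathcal A_{11}=\begin{bmatrix} F_{p_1}&\mathcal T&\dots&\mathcal T \\ &F_{p_2}&\ddots&\vdots \\ &&\ddots&\mathcal T \\ 0&&&F_{p_l} \end{bmatrix},\qquad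 \mathcal A_{44}=\begin{bmatrix} G_{q_1}^T&\mathcal T&\dots&\mathcal T \\ &G_{q_2}^T&\ddots&\vdots \\ &&\ddots&\mathcal T \\ 0&&&G_{q_r}^T \end{bmatrix},$$ $$\mathcal B_{11}=\begin{bmatrix} G_{p_1}^T+\mathcal T&&&0 \\ \mathcal T&G_{p_2}^T+\mathcal T&& \\ \vdots&\ddots&\ddots& \\ \mathcal T&\dots&\mathcal T&G_{p_l}^T+\mathcal T \end{bmatrix},\qquad \mathcal B_{44}=\begin{bmatrix} F_{q_1}+\mathcal T&&&0 \\ \mathcal T&F_{q_2}+\mathcal T&& \\ \vdots&\ddots&\ddots& \\ \mathcal T&\dots&\mathcal T&F_{q_r}+\mathcal T \end{bmatrix}.$$
   Context: All matrices are complex. Any of the direct summands may be absent, and matrices with zero rows or zero columns are allowed. Contragredient equivalence and deformations. Pairs $(A,B)$ of an $m\times n$ matrix $A$ and an $n\times m$ matrix $B$ are considered up to contragredient equivalence $(A,B)\mapsto(S^{-1}AR,R^{-1}BS)$ with $S,R$ nonsingular. A deformation of a pair $(C,D)$ is a pair of matrix functions $(\mathcal C,\mathcal D)(\alpha_1,\dots,\alpha_k)$ on a neighborhood of $\vec0\in\mathbb C^k$, holomorphic at $\vec 0$ and equal to $(C,D)$ at $\vec0$; deformations coinciding near $\vec 0$ are identified. It is versal if all pairs $(C+E_1,D+E_2)$ in some neighborhood of $(C,D)$ reduce to the form $$(\mathcal C,\mathcal D)(h_1(E),\dots,h_k(E))=\big(\mathcal S(E)^{-1}(C+E_1)\mathcal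 R(E),\ \mathcal R(E)^{-1}(D+E_2)\mathcal S(E)\big),\quad \mathcal S(0)=I,\ \mathcal R(0)=I,$$ where $E=(E_1,E_2)$ and $\mathcal S,\mathcal R$ are matrix functions of the entries of $E$ holomorphic at zero. It is miniversal if it is versal with the minimal number of parameters. It is simple if, writing it as $(C+\mathcal P,D+\mathcal Q)$, $k$ of the entries of $\mathcal P,\mathcal Q$ are the independent parameters $\alpha_1,\dots,\alpha_k$ and all other entries are zero. Matrices. $J_m(\lambda)$ is the $m\times m$ Jordan block with ones above the diagonal. For $r\ge1$, $F_r$ and $G_r$ are the $r\times(r-1)$ matrices $F_r=\begin{bmatrix} I_{r-1} \\ 0 \end{bmatrix}$ and $G_r=\begin{bmatrix} 0 \\ I_{r-1} \end{bmatrix}$. Parameter blocks. All stars denote independent parameters; stars in different positions (in particular, in different occurrences of $\mathcal T,\mathcal H,\mathcal H_{\vartriangle},\mathcal H_{\rhd}$) are distinct parameters. For each $p,q$, $\mathcal T_{pq}$ is the $p\times q$ matrix with stars in all positions of the first column if $p<q$, in all positions of the last row if $p\ge q$, and zeros elsewhere. $\mathcal T$ denotes the matrix $\mathcal T_{pq}$ of the size determined by its position. For a matrix $M$, $M_{\vartriangle}$ is obtained from $M$ by adding a zero row at the top, and $M_{\rhd}$ is obtained from $M$ by adding a zero column on the right. In $\mathcal A$ and $\mathcal B$, the row and column strips are partitioned according to the summands $(F_{p_i},G_{p_i}^T)$, the Jordan blocks of $J(0)$, the Jordan blocks of $J'(0)$, and the summands $(G_{q_i}^T,F_{q_i})$.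 With respect to this partition, $\mathcal H$ denotes a block matrix all of whose blocks have the form $\mathcal T$; $\mathcal H_{\vartriangle}$ denotes a block matrix all of whose blocks have the form $\mathcal T_{\vartriangle}$; and $\mathcal H_{\rhd}$ denotes a block matrix all of whose blocks have the form $\mathcal T_{\rhd}$ (sizes being determined by position). Arnold deformation. Jordan matrices with a single eigenvalue are written as $J(\lambda)=J_{n_1}(\lambda)\oplus\dots\oplus J_{n_t}(\lambda)$ with $n_1\ge\dots\ge n_t$; the Arnold deformation of $J(\lambda)$ is $J(\lambda)+\mathcal H$ with $\mathcal H=[\mathcal T_{n_i,n_j}]_{i,j=1}^t$. For $J=J(\lambda_1)\oplus\dots\oplus J(\lambda_\tau)$ with distinct $\lambda_i$, the Arnold deformation is $J+\mathcal K:=(J(\lambda_1)+\mathcal H_1)\oplus\dots\oplus(J(\lambda_\tau)+\mathcal H_\tau)$, the direct sum of the Arnold deformations of the $J(\lambda_i)$. *)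

(* Defs.v *)
(* The field of complex numbers is R[i] for R : realType; the definitions make
   sense over any numFieldType. *)
From HB Require Import structures.
From mathcomp Require Import all_boot all_order all_algebra.
From mathcomp Require Export complex.
From mathcomp Require Import classical_sets boolp filter reals topology.
From mathcomp Require Import normedtype derive.

Set Implicit Arguments.
Unset Strict Implicit.
Unset Printing Implicit Defensive.

Import Order.TTheory GRing.Theory Num.Theory.
Import numFieldNormedType.Exports.

Local Open Scope classical_set_scope.
Local Open Scope ring_scope.

Section Deformations.
Variable K : numFieldType.

(* For K = R[i], [differentiable] is Frechet differentiability over the complex
   numbers, so this is holomorphy on a neighborhood of 0. *)
Definition holomorphic_at0 (V W : normedModType K) (f : V -> W) : Prop :=
  \forall x \near (0 : V), differentiable f x.

Variables m n : nat.

Notation pairs := ('M[K]_(m, n) * 'M[K]_(n, m))%type.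

(* A deformation is a germ at 0: it is represented by a total function whose
   values away from 0 are irrelevant to all the notions below. *)
Definition deformation (C : 'M[K]_(m, n)) (D : 'M[K]_(n, m)) (k : nat)
    (CD : 'rV[K]_k -> pairs) : Prop :=
  holomorphic_at0 CD /\ CD 0 = (C, D).

(* [h] is holomorphic with [h 0 = 0], as usual for versality; that [h E] tends
   to 0 is what makes [CD (h E)] depend on the germ of [CD] only. *)
Definition versal (C : 'M[K]_(m, n)) (D : 'M[K]_(n, m)) (k : nat)
    (CD : 'rV[K]_k -> pairs) : Prop :=
  deformation C D CD /\
  exists (h : pairs -> 'rV[K]_k) (S : pairs -> 'M[K]_m) (R : pairs -> 'M[K]_n),
    [/\ holomorphic_at0 h, holomorphic_at0 S & holomorphic_at0 R] /\
    [/\ h 0 = 0, S 0 = 1%:M & R 0 = 1%:M] /\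
    \forall E \near (0 : pairs),
      [/\ S E \in unitmx, R E \in unitmx &
          CD (h E) = (invmx (S E) *m (C + E.1) *m R E,
                      invmx (R E) *m (D + E.2) *m S E)].

Definition miniversal (C : 'M[K]_(m, n)) (D : 'M[K]_(n, m)) (k : nat)
    (CD : 'rV[K]_k -> pairs) : Prop :=
  versal C D CD /\
  forall (k' : nat) (CD' : 'rV[K]_k' -> pairs), versal C D CD' -> (k <= k')%N.

(* [inl (i, j)] is an entry of the first matrix of a pair, [inr (i, j)] an entry
   of the second one. *)
Definition entry : finType := ('I_m * 'I_n + 'I_n * 'I_m)%type.

(* (C, D) with the t-th parameter added to the entry [f t]. *)
Definition param_pair (C : 'M[K]_(m, n)) (D : 'M[K]_(n, m)) (k : nat)
    (f : 'I_k -> entry) (alpha : 'rV[K]_k) : pairs :=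
  (\matrix_(i, j) (C i j + \sum_(t < k | f t == inl (i, j)) alpha 0 t),
   \matrix_(i, j) (D i j + \sum_(t < k | f t == inr (i, j)) alpha 0 t)).

Definition simple_deformation (C : 'M[K]_(m, n)) (D : 'M[K]_(n, m)) (k : nat)
    (CD : 'rV[K]_k -> pairs) : Prop :=
  deformation C D CD /\
  exists2 f : 'I_k -> entry, injective f &
    \forall alpha \near (0 : 'rV[K]_k), CD alpha = param_pair C D f alpha.

(* A pattern of stars is a pair of boolean matrices, [true] marking a star. *)
Definition stars (P : 'M[bool]_(m, n)) (Q : 'M[bool]_(n, m)) : {set entry} :=
  [set x : entry | match x with
                   | inl ij => P ij.1 ij.2
                   | inr ij => Q ij.1 ij.2
                   end].

(* (C + P, D + Q) with all the stars of P and Q read as independent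
   parameters. *)
Definition star_deformation (C : 'M[K]_(m, n)) (D : 'M[K]_(n, m))
    (P : 'M[bool]_(m, n)) (Q : 'M[bool]_(n, m)) :
    'rV[K]_#|stars P Q| -> pairs :=
  param_pair C D (fun t : 'I_#|stars P Q| => enum_val t).

End Deformations.

Arguments star_deformation {K m n} C D P Q alpha.

Definition block4 (X : Type) (m1 m2 m3 m4 n1 n2 n3 n4 : nat)
    (a11 : 'M[X]_(m1, n1)) (a12 : 'M[X]_(m1, n2))
    (a13 : 'M[X]_(m1, n3)) (a14 : 'M[X]_(m1, n4))
    (a21 : 'M[X]_(m2, n1)) (a22 : 'M[X]_(m2, n2))
    (a23 : 'M[X]_(m2, n3)) (a24 : 'M[X]_(m2, n4))
    (a31 : 'M[X]_(m3, n1)) (a32 : 'M[X]_(m3, n2))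
    (a33 : 'M[X]_(m3, n3)) (a34 : 'M[X]_(m3, n4))
    (a41 : 'M[X]_(m4, n1)) (a42 : 'M[X]_(m4, n2))
    (a43 : 'M[X]_(m4, n3)) (a44 : 'M[X]_(m4, n4)) :
    'M[X]_((m1 + m2) + (m3 + m4), (n1 + n2) + (n3 + n4)) :=
  block_mx (block_mx a11 a12 a21 a22) (block_mx a13 a14 a23 a24)
           (block_mx a31 a32 a41 a42) (block_mx a33 a34 a43 a44).

(* Direct sum of rectangular matrices ([\mxdiag] is for square ones); the
   [conform_mx] is only a cast, as the two sizes agree when i = j. *)
Definition dsum (X : nmodType) (t : nat) (m n : 'I_t -> nat)
    (M : forall i, 'M[X]_(m i, n i)) : 'M[X]_(\sum_i m i, \sum_i n i) :=
  \mxblock_(i < t, j < t) (if i == j then conform_mx 0 (M i) else 0).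

Section CanonicalMatrices.
Variable K : numFieldType.

Definition Jblock (lambda : K) (n : nat) : 'M[K]_n :=
  \matrix_(i < n, j < n) (lambda *+ (i == j) + (j == i.+1 :> nat)%:R).

Definition Jmx (lambda : K) (t : nat) (n : 'I_t -> nat) : 'M[K]_(\sum_i n i) :=
  \mxdiag_(i < t) Jblock lambda (n i).

Definition Fmx (r : nat) : 'M[K]_(r, r.-1) :=
  \matrix_(i < r, j < r.-1) (i == j :> nat)%:R.

Definition Gmx (r : nat) : 'M[K]_(r, r.-1) :=
  \matrix_(i < r, j < r.-1) (i == j.+1 :> nat)%:R.

Section Pair.
Variables (l : nat) (p : 'I_l -> nat).   (* (F_p, G_p^T) *)
Variables (t0 : nat) (n0 : 'I_t0 -> nat). (* block sizes of J(0) *)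
Variables (t1 : nat) (n1 : 'I_t1 -> nat). (* block sizes of J'(0) *)
Variables (r : nat) (q : 'I_r -> nat).   (* (G_q^T, F_q) *)

Definition canA :=
  block4 (dsum (fun i => Fmx (p i))) 0 0 0
         0 (1%:M : 'M[K]_(\sum_i n0 i)) 0 0
         0 0 (Jmx 0 n1) 0
         0 0 0 (dsum (fun i => (Gmx (q i))^T)).

Definition canB :=
  block4 (dsum (fun i => (Gmx (p i))^T)) 0 0 0
         0 (Jmx 0 n0) 0 0
         0 0 (1%:M : 'M[K]_(\sum_i n1 i)) 0
         0 0 0 (dsum (fun i => Fmx (q i))).

End Pair.
End CanonicalMatrices.

Arguments Fmx {K} r.
Arguments Gmx {K} r.

(* In a matrix of booleans, 0 is the matrix without stars. *)
Section Stars.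

Definition star (p q i j : nat) : bool :=
  if (p < q)%N then j == 0%N else i.+1 == p.

Definition Tmx (p q : nat) : 'M[bool]_(p, q) :=
  \matrix_(i < p, j < q) star p q i j.

(* The p x q matrices T_{p-1,q} with a zero row added at the top, and
   T_{p,q-1} with a zero column added on the right. *)
Definition Tmx_top (p q : nat) : 'M[bool]_(p, q) :=
  \matrix_(i < p, j < q) ((0 < i)%N && star p.-1 q i.-1 j).

Definition Tmx_right (p q : nat) : 'M[bool]_(p, q) :=
  \matrix_(i < p, j < q) ((j < q.-1)%N && star p q.-1 i j).

Section Blocks.
Variables (s t : nat) (a : 'I_s -> nat) (b : 'I_t -> nat).

Definition Hmx : 'M[bool]_(\sum_i a i, \sum_j b j) :=
  \mxblock_(i < s, j < t) Tmx (a i) (b j).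
Definition Hmx_top : 'M[bool]_(\sum_i a i, \sum_j b j) :=
  \mxblock_(i < s, j < t) Tmx_top (a i) (b j).
Definition Hmx_right : 'M[bool]_(\sum_i a i, \sum_j b j) :=
  \mxblock_(i < s, j < t) Tmx_right (a i) (b j).

End Blocks.

Definition Tupper (t : nat) (a b : 'I_t -> nat) :
    'M[bool]_(\sum_i a i, \sum_j b j) :=
  \mxblock_(i < t, j < t) (if (i < j)%N then Tmx (a i) (b j) else 0).

Definition Tlower (t : nat) (a b : 'I_t -> nat) :
    'M[bool]_(\sum_i a i, \sum_j b j) :=
  \mxblock_(i < t, j < t) (if (j <= i)%N then Tmx (a i) (b j) else 0).

Section Pair.
Variables (l : nat) (p : 'I_l -> nat) (t0 : nat) (n0 : 'I_t0 -> nat).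
Variables (t1 : nat) (n1 : 'I_t1 -> nat) (r : nat) (q : 'I_r -> nat).

Local Notation p' := (fun i => (p i).-1).
Local Notation q' := (fun i => (q i).-1).

(* The stars of the matrices \mathcal A and \mathcal B. *)
Definition starsA :=
  block4 (Tupper p p') (Hmx_top p n0) (Hmx p n1)  (Hmx p q)
         0             0              (Hmx n0 n1) (Hmx_right n0 q)
         0             0              (Hmx n1 n1) (Hmx n1 q)
         0             0              0           (Tupper q' q).

Definition starsB :=
  block4 (Tlower p' p)    0           0              0
         (Hmx n0 p)       (Hmx n0 n0) 0              0
         (Hmx_right n1 p) (Hmx n1 n0) 0              0
         (Hmx q p)        (Hmx q n0)  (Hmx_top q n1) (Tlower q q').

End Pair.
End Stars.

Section Arnold.
Variables (tau : nat) (t : 'I_tau -> nat) (n : forall a, 'I_(t a) -> nat).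

Definition Jfull (K : numFieldType) (lambda : 'I_tau -> K) :
    'M[K]_(\sum_a \sum_i n (a := a) i) :=
  \mxdiag_(a < tau) Jmx (lambda a) (n (a := a)).

(* The stars of the Arnold deformation of [Jfull lambda]. *)
Definition starsK : 'M[bool]_(\sum_a \sum_i n (a := a) i) :=
  \mxdiag_(a < tau) Hmx (n (a := a)) (n (a := a)).

End Arnold.

(* Main.v *)
Require Import Defs.
From HB Require Import structures.
From mathcomp Require Import all_boot all_order all_algebra.
From mathcomp Require Import sesquilinear complex ring lra zify.
From mathcomp Require Import classical_sets boolp functions filter reals.
From mathcomp Require Import interval_inference topology prodnormedzmodule.
From mathcomp Require Import normedtype derive landau sequences.

Set Implicit Arguments.
Unset Strict Implicit.
Unset Printing Implicit Defensive.

Import Order.TTheory GRing.Theory Num.Theory.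
Import numFieldNormedType.Exports.

Local Open Scope ring_scope.

(**
The pairs (X C - C Y, Y D - D X) are the tangent vectors at (C, D) to its orbit
under contragredient equivalence.  The theorem follows from two facts: the star
directions form a complement of this tangent space, and a simple deformation
whose directions form such a complement is miniversal.

The second fact is the transversality principle ([transversal_miniversal]).  If
the star directions and the tangent space span, the equations
S (C + P) = (C + E1) T and T (D + Q) = (D + E2) S, with S = 1 + X and T = 1 + Y,
become a quadratic fixed point equation for the pair
(X C - C Y + P, Y D - D X + Q).  It is solved by contraction, and its solution
is holomorphic ([quadratic_implicit]); this gives versality.  Conversely,
differentiating the identity that defines versality shows that a versal
deformation needs at least as many parameters as there are star directions
independent modulo the tangent space ([independent_minimal]).

For the first fact, each summand of the canonical pair is a chain of basis
vectors, taken alternately from the two spaces, along which C and D move one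
step: (I, J(0)), (J'(0), I), (F, G^T) and (G^T, F) differ only in the parity of
the length of the chain and in the side where it starts.  A pair (E1, E2) of
blocks joining two nilpotent chains is then a matrix whose rows are the first
chain and whose columns are the second one, restricted to the places of one
parity, and the tangent space consists of the commutators with nilpotent Jordan
blocks.  Modulo these, a matrix unit slides along its diagonal
([nilpotent_shift]).  If the diagonal meets the end of one of the chains too
early, the unit is itself tangent; otherwise, when the diagonal runs from the
first column to the last row, all its units are congruent, and the sum of its
entries is a linear form vanishing on the tangent space ([psi_tangent]).  So a
complement is obtained by putting one star, anywhere, on each diagonal of the
latter kind, and the patterns of the theorem do exactly this ([shape_exists],
[starA_allowed], [starB_allowed], [star_like_shape]).

The blocks (I, J) are chains as well, with an extra arrow backwards of weight
the eigenvalue.  Their first matrix can be cleared ([reduce_to_col]), after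
which different eigenvalues leave nothing ([distinct_lam]) and equal ones leave
the diagonals of two Jordan blocks, as in Arnold's theorem.
*)

(** * Star directions *)

Section StarDirections.
Variables (K : fieldType) (m n : nat).
Variables (C : 'M[K]_(m, n)) (D : 'M[K]_(n, m)).
Variables (k : nat) (f : 'I_k -> entry m n).

Definition paramA (a : 'rV[K]_k) : 'M[K]_(m, n) :=
  \matrix_(i, j) \sum_(t < k | f t == inl (i, j)) a 0 t.
Definition paramB (a : 'rV[K]_k) : 'M[K]_(n, m) :=
  \matrix_(j, i) \sum_(t < k | f t == inr (j, i)) a 0 t.

Fact paramA_linear : linear paramA.
Proof.
move=> a u v; apply/matrixP => i j; rewrite !mxE mulr_sumr -big_split /=.
by apply: eq_bigr => t _; rewrite !mxE.
Qed.
HB.instance Definition _ := GRing.isLinear.Build _ _ _ _ paramA paramA_linear.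

Fact paramB_linear : linear paramB.
Proof.
move=> a u v; apply/matrixP => i j; rewrite !mxE mulr_sumr -big_split /=.
by apply: eq_bigr => t _; rewrite !mxE.
Qed.
HB.instance Definition _ := GRing.isLinear.Build _ _ _ _ paramB paramB_linear.

(** The pairs (X C - C Y, Y D - D X) are the tangent vectors at (C, D) to the
    orbit of contragredient equivalence.  [spanning] and [independent] together
    say that the parameter directions are a complement of this tangent space. *)
Definition spanning :=
  forall E : 'M[K]_(m, n) * 'M[K]_(n, m), exists (X : 'M_m) (Y : 'M_n) a,
    E = (X *m C - C *m Y + paramA a, Y *m D - D *m X + paramB a).

Definition independent :=
  forall (X : 'M_m) (Y : 'M_n) a, paramA a = X *m C - C *m Y ->
    paramB a = Y *m D - D *m X -> a = 0.

End StarDirections.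

(** * The tangent space of a direct sum of chains *)

Section Chains.
Variables (K : fieldType) (m n : nat).
Variables (C : 'M[K]_(m, n)) (D : 'M[K]_(n, m)).
Variables (I : eqType) (len : I -> nat) (lam : I -> K) (side : I -> bool).
Local Notation vertex := ('I_m + 'I_n)%type.
Variables (blk : vertex -> I) (pos : vertex -> nat).

(** The rows and the columns of C are the vertices of a graph whose components
    are chains, one for each summand of the canonical pair: [blk v] is the chain
    of [v], [pos v] its place there, and C and D together move each vertex one
    step along its chain, rows and columns alternating.  [side b] tells that the
    chain [b] starts with a column.  On a chain with eigenvalue [lam b] the
    matrix D also goes back, with weight [lam b], along the arrows of C. *)
Definition is_col (v : vertex) := if v is inr _ then true else false.
Definition arrow (u v : vertex) := (blk u == blk v) && (pos v == (pos u).+1).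

Hypothesis pos_lt : forall v, (pos v < len (blk v))%N.
Hypothesis pos_inj : forall u v, blk u = blk v -> pos u = pos v -> u = v.
Hypothesis pos_surj : forall b k, (k < len b)%N -> exists2 v, blk v = b & pos v = k.
Hypothesis pos_odd : forall v, odd (pos v) = is_col v (+) side (blk v).
Hypothesis lam_even : forall b, lam b != 0 -> ~~ side b /\ ~~ odd (len b).
Hypothesis C_arrow : forall i j, C i j = (arrow (inl i) (inr j))%:R.
Hypothesis D_arrow : forall j i, D j i = (arrow (inr j) (inl i))%:R +
  (arrow (inl i) (inr j))%:R * lam (blk (inl i)).

Lemma arrow_col u v : arrow u v -> is_col v = ~~ is_col u.
Proof.
move=> /andP[/eqP b /eqP p]; have := pos_odd u; have := pos_odd v.
rewrite p b /= => hv hu; move: hv; rewrite hu.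
by case: (is_col u); case: (is_col v); case: (side _).
Qed.

Lemma arrow_succ u : ((pos u).+1 < len (blk u))%N -> exists v, arrow u v.
Proof.
by move=> /pos_surj[v b p]; exists v; rewrite /arrow b p !eqxx.
Qed.

Lemma arrow_pred v : (0 < pos v)%N -> exists u, arrow u v.
Proof.
move=> p0; have [|u b p] := @pos_surj (blk v) (pos v).-1.
  by have := pos_lt v; lia.
by exists u; rewrite /arrow b p eqxx prednK ?eqxx.
Qed.

Lemma arrow_sum (V : zmodType) (F : vertex -> V) u v : arrow u v ->
  \sum_(w | arrow u w) F w = F v.
Proof.
move=> uv; apply: big_pred1 => w; apply/idP/eqP => [|->//].
move: uv => /andP[/eqP b /eqP p] /andP[/eqP b' /eqP p'].
by apply: pos_inj; rewrite -?b -?b' ?p ?p'.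
Qed.

Lemma prev_sum (V : zmodType) (F : vertex -> V) u v : arrow u v ->
  \sum_(w | arrow w v) F w = F u.
Proof.
move=> uv; apply: big_pred1 => w; apply/idP/eqP => [|->//].
move: uv => /andP[/eqP b /eqP p] /andP[/eqP b' /eqP p'].
by apply: pos_inj; rewrite ?b ?b' //; lia.
Qed.

Lemma arrow_sum0 (V : zmodType) (F : vertex -> V) u : (pos u).+1 = len (blk u) ->
  \sum_(w | arrow u w) F w = 0.
Proof.
move=> e; apply: big_pred0 => w; apply/negP => /andP[/eqP b /eqP p].
by have := pos_lt w; rewrite p -b e ltnn.
Qed.

Lemma prev_sum0 (V : zmodType) (F : vertex -> V) v : pos v = 0%N ->
  \sum_(w | arrow w v) F w = 0.
Proof. by move=> e; apply: big_pred0 => w; rewrite /arrow e andbF. Qed.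

(** The matrix units of both members of a pair, indexed by the vertices that
    they join, so that C and D can be treated alike; vertices of the same side
    are joined by none, whence the default value. *)
Definition unit_pair (u v : vertex) : 'M[K]_(m, n) * 'M[K]_(n, m) :=
  match u, v with
  | inl i, inr j => (delta_mx i j, 0)
  | inr j, inl i => (0, delta_mx j i)
  | _, _ => 0
  end.

Lemma delta_mulmx a b c (i : 'I_a) (j : 'I_b) (M : 'M[K]_(b, c)) :
  delta_mx i j *m M = \sum_k M j k *: delta_mx i k.
Proof.
apply/matrixP => x y; rewrite !mxE summxE (bigD1 j) //= big1 => [|k kj].
  rewrite (bigD1 y) //= big1 => [|k ky]; rewrite !mxE ?eqxx ?andbT ?addr0.
    by rewrite mulrC.
  by rewrite [y == k]eq_sym (negPf ky) andbF mulr0.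
by rewrite !mxE (negPf kj) andbF mul0r.
Qed.

Lemma mulmx_delta a b c (i : 'I_b) (j : 'I_c) (M : 'M[K]_(a, b)) :
  M *m delta_mx i j = \sum_k M k i *: delta_mx k j.
Proof.
apply/matrixP => x y; rewrite !mxE summxE (bigD1 i) //= big1 => [|k ki].
  rewrite (bigD1 x) //= big1 => [|k kx]; rewrite !mxE ?eqxx ?andbT ?addr0 //.
  by rewrite [x == k]eq_sym (negPf kx) mulr0.
by rewrite !mxE (negPf ki) mulr0.
Qed.

Lemma sum_pair (V W : zmodType) (J : finType) (P : pred J) (F : J -> V) (G : J -> W) :
  \sum_(j | P j) (F j, G j) = (\sum_(j | P j) F j, \sum_(j | P j) G j).
Proof.
by apply: (big_rec3 (fun x y z => z = (x, y))) => // j x y z _ ->.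
Qed.

(** The diagonals, in the block of two chains, on which a star is needed: those
    running from the first column of the block to its last row. *)
Definition allowed u v :=
  ((pos v <= pos u) && (pos v + len (blk u) <= pos u + len (blk v)))%N.

Lemma lam_row v : lam (blk v) != 0 -> ~~ is_col v -> exists w, arrow v w.
Proof.
move=> /lam_even[sv lv] cv; apply: arrow_succ; have := pos_lt v.
have := pos_odd v; rewrite (negPf sv) (negPf cv) /= => ov; lia.
Qed.

Lemma lam_col u : lam (blk u) != 0 -> is_col u -> exists w, arrow w u.
Proof.
move=> /lam_even[su lu] cu; apply: arrow_pred.
have := pos_odd u; rewrite (negPf su) cu /=; lia.
Qed.

(** ** The stars and the tangent space span *)

(* [S] stands for the sum of the tangent space and the span of the stars. *)
Section Spanning.
Variable S : 'M[K]_(m, n) * 'M[K]_(n, m) -> Prop.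
Hypothesis S0 : S 0.
Hypothesis SD : forall E F, S E -> S F -> S (E + F).
Hypothesis SZ : forall a E, S E -> S (a *: E).
Hypothesis S_tangent : forall X Y, S (X *m C - C *m Y, Y *m D - D *m X).

Let SN E : S E -> S (- E).
Proof. by rewrite -scaleN1r; exact: SZ. Qed.

Let SB E F : S E -> S F -> S (E - F).
Proof. by move=> SE SF; apply: SD => //; exact: SN. Qed.

Let S_sum (J : Type) (r : seq J) (P : pred J) (F : J -> _) :
  (forall j, P j -> S (F j)) -> S (\sum_(j <- r | P j) F j).
Proof. by move=> SF; elim/big_rec : _ => // j x Pj; apply: SD; exact: SF. Qed.

(** The tangent vector of an elementary X: multiplying by C moves its second
    vertex one step forward, multiplying by D moves its first one back. *)
Lemma tangent_row i i' :
  S (\sum_(w | arrow (inl i') w) unit_pair (inl i) w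
     - \sum_(w | arrow w (inl i)) unit_pair w (inl i')
     - lam (blk (inl i)) *:
         \sum_(w | arrow (inl i) w) unit_pair w (inl i')).
Proof.
have := S_tangent (delta_mx i i') 0; congr S.
rewrite mulmx0 mul0mx subr0 sub0r delta_mulmx mulmx_delta.
rewrite !big_sumType /=.
rewrite !big1_eq ?add0r ?addr0 !sum_pair !big1_eq.
congr pair; rewrite /= ?scaler0 ?subr0 ?sub0r.
  rewrite [RHS]big_mkcond; apply: eq_bigr => k _.
  by rewrite C_arrow; case: arrow; rewrite ?scale1r ?scale0r.
rewrite -opprD scaler_sumr; congr (- _).
rewrite [X in _ = X + _]big_mkcond [X in _ = _ + X]big_mkcond -big_split.
apply: eq_bigr => k _; rewrite D_arrow scalerDl.
by do 2![case: arrow]; rewrite ?mul1r ?mul0r ?scale1r ?scale0r.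
Qed.

(** The same for an elementary Y, where the extra term of D falls on the second
    vertex. *)
Lemma tangent_col j j' :
  S (\sum_(w | arrow (inr j') w) unit_pair (inr j) w
     - \sum_(w | arrow w (inr j)) unit_pair w (inr j')
     + lam (blk (inr j')) *:
         \sum_(w | arrow w (inr j')) unit_pair (inr j) w).
Proof.
have := S_tangent 0 (delta_mx j j'); congr S.
rewrite mulmx0 mul0mx subr0 sub0r delta_mulmx mulmx_delta.
rewrite !big_sumType /=.
rewrite !big1_eq ?add0r ?addr0 !sum_pair !big1_eq.
congr pair; rewrite /= ?scaler0 ?subr0 ?sub0r ?addr0.
  congr (- _); rewrite [RHS]big_mkcond; apply: eq_bigr => k _.
  by rewrite C_arrow; case: arrow; rewrite ?scale1r ?scale0r.
rewrite scaler_sumr.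
rewrite [X in _ = X + _]big_mkcond [X in _ = _ + X]big_mkcond -big_split.
apply: eq_bigr => k _; rewrite D_arrow scalerDl.
case: (boolP (arrow (inl k) _)) => [/andP[/eqP-> _]|_].
  by case: arrow; rewrite ?mul1r ?scale1r ?scale0r.
by case: arrow; rewrite ?mul0r ?scale1r ?scale0r.
Qed.

Let SZI a E : a != 0 -> S (a *: E) -> S E.
Proof. by move=> a0 /(SZ a^-1); rewrite scalerA mulVf // scale1r. Qed.

Let SDl E F : S F -> S (E + F) -> S E.
Proof. by move=> SF /SB/(_ SF); rewrite addrK. Qed.

Section Nilpotent.
Lemma tangent_nilpotent u v : is_col u = is_col v ->
  lam (blk u) = 0 -> lam (blk v) = 0 ->
  S (\sum_(w | arrow v w) unit_pair u w - \sum_(w | arrow w u) unit_pair w v).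
Proof.
case: u v => [i|j] [i'|j'] // _ u0 v0.
  by have := tangent_row i i'; rewrite u0 scale0r subr0.
by have := tangent_col j j'; rewrite v0 scale0r addr0.
Qed.

(** Modulo tangent vectors, a matrix unit slides freely along its diagonal. *)
Lemma nilpotent_shift u u' v v' : is_col u' != is_col v' ->
  lam (blk u) = 0 -> lam (blk v) = 0 -> arrow u u' -> arrow v v' ->
  S (unit_pair u v) <-> S (unit_pair u' v').
Proof.
move=> uv' u0 v0 uu' vv'.
have := @tangent_nilpotent u' v; rewrite (arrow_sum _ vv') (prev_sum _ uu').
have -> : lam (blk u') = 0 by case/andP: uu' => /eqP <-.
move=> /(_ _ erefl v0) h.
have {}h : S (unit_pair u' v' - unit_pair u v).
  by apply: h; move: uv'; rewrite (arrow_col vv'); do 2!case: is_col.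
split=> Suv; first by rewrite -(subrK (unit_pair u v) (unit_pair _ _)); exact: SD.
rewrite -[unit_pair u v](subrK (unit_pair u' v')); apply: SD => //.
by rewrite -opprB; exact: SN.
Qed.

(** Sliding such a unit towards the beginnings of the chains, one reaches the
    beginning of the first chain while the second one still continues; there
    the tangent vector has a single term. *)
Lemma nilpotent_above u v : is_col u != is_col v ->
  lam (blk u) = 0 -> lam (blk v) = 0 -> (pos u < pos v)%N -> S (unit_pair u v).
Proof.
move: {2}(pos u) (erefl (pos u)) => k; elim: k u v => [|k IH] u v uk uv u0 v0 ltuv.
  have [v' v'v] : exists v', arrow v' v by apply: arrow_pred; lia.
  have v'0 : lam (blk v') = 0 by case/andP: v'v => /eqP ->.
  have := @tangent_nilpotent u v' _ u0 v'0.
  rewrite (arrow_sum _ v'v) (prev_sum0 _ uk) subr0; apply.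
  by move: uv; rewrite (arrow_col v'v); do 2!case: is_col.
have [v' v'v] : exists v', arrow v' v by apply: arrow_pred; lia.
have [u' u'u] : exists u', arrow u' u by apply: arrow_pred; lia.
have v'0 : lam (blk v') = 0 by case/andP: v'v => /eqP ->.
have u'0 : lam (blk u') = 0 by case/andP: u'u => /eqP ->.
apply/(nilpotent_shift uv u'0 v'0 u'u v'v); apply: IH => //.
- by case/andP: u'u => _ /eqP; lia.
- by move: uv; rewrite (arrow_col v'v) (arrow_col u'u); do 2!case: is_col.
- by case/andP: u'u => _ /eqP; case/andP: v'v => _ /eqP; lia.
Qed.

(** Here one slides towards the ends, and the second chain ends first. *)
Lemma nilpotent_below u v : is_col u != is_col v ->
  lam (blk u) = 0 -> lam (blk v) = 0 ->
  (pos u + len (blk v) < pos v + len (blk u))%N -> S (unit_pair u v).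
Proof.
move: {2}(len (blk v) - pos v)%N (erefl (len (blk v) - pos v)%N) => k.
elim: k u v => [|k IH] u v vk uv u0 v0 ltuv.
  by have := pos_lt v; lia.
have [u' uu'] : exists u', arrow u u' by apply: arrow_succ; have := pos_lt v; lia.
have u'0 : lam (blk u') = 0 by case/andP: uu' => /eqP <-.
have [vlen|vlen] := eqVneq (pos v).+1 (len (blk v)).
  have := @tangent_nilpotent u' v _ u'0 v0.
  rewrite (arrow_sum0 _ vlen) (prev_sum _ uu') sub0r => h.
  rewrite -[unit_pair u v]opprK; apply: SN; apply: h.
  by move: uv; rewrite (arrow_col uu'); do 2!case: is_col.
have [v' vv'] : exists v', arrow v v' by apply: arrow_succ; have := pos_lt v; lia.
have uv' : is_col u' != is_col v'.
  by move: uv; rewrite (arrow_col vv') (arrow_col uu'); do 2!case: is_col.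
apply/(nilpotent_shift uv' u0 v0 uu' vv').
case/andP: uu' => /eqP bu /eqP pu; case/andP: vv' => /eqP bv /eqP pv.
by apply: IH; rewrite -?bu -?bv ?pu ?pv //; lia.
Qed.

Lemma nilpotent_diagonal u v u' v' : is_col u != is_col v ->
  lam (blk u) = 0 -> lam (blk v) = 0 ->
  blk u = blk u' -> blk v = blk v' -> (pos u' + pos v = pos u + pos v')%N ->
  S (unit_pair u' v') -> S (unit_pair u v).
Proof.
move=> uv u0 v0 bu bv.
have [k] := ubnP ((pos u - pos u') + (pos u' - pos u))%N.
elim: k u v uv u0 v0 bu bv => // k IH u v uv u0 v0 bu bv ltk pp Suv'.
have [ltu|ltu|equ] := ltngtP (pos u) (pos u').
- have [w uw] : exists w, arrow u w.
    by apply: arrow_succ; have := pos_lt u'; rewrite bu; lia.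
  have [x vx] : exists w, arrow v w.
    by apply: arrow_succ; have := pos_lt v'; rewrite bv; lia.
  have wx : is_col w != is_col x.
    by move: uv; rewrite (arrow_col uw) (arrow_col vx); do 2!case: is_col.
  apply/(nilpotent_shift wx u0 v0 uw vx).
  case/andP: uw => /eqP bw /eqP pw; case/andP: vx => /eqP bx /eqP px.
  by apply: IH; rewrite -?bw -?bx ?pw ?px //; lia.
- have [w uw] : exists w, arrow w u by apply: arrow_pred; lia.
  have [x vx] : exists w, arrow w v by apply: arrow_pred; lia.
  have wx : is_col w != is_col x.
    by move: uv; rewrite (arrow_col uw) (arrow_col vx); do 2!case: is_col.
  have w0 : lam (blk w) = 0 by case/andP: uw => /eqP ->.
  have x0 : lam (blk x) = 0 by case/andP: vx => /eqP ->.
  apply/(nilpotent_shift uv w0 x0 uw vx).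
  case/andP: uw => /eqP bw /eqP pw; case/andP: vx => /eqP bx /eqP px.
  by apply: IH; rewrite ?bw ?bx ?pw ?px //; lia.
- have -> : u = u' by apply: pos_inj.
  by have -> : v = v' by apply: pos_inj => //; lia.
Qed.

End Nilpotent.

Section Eigenvalues.

Lemma tangent_colv u v : is_col u -> is_col v ->
  S (\sum_(w | arrow v w) unit_pair u w - \sum_(w | arrow w u) unit_pair w v
     + lam (blk v) *: \sum_(w | arrow w v) unit_pair u w).
Proof. by case: u v => [i|j] [i'|j'] // _ _; exact: tangent_col. Qed.

Lemma tangent_rowv u v : ~~ is_col u -> ~~ is_col v ->
  S (\sum_(w | arrow v w) unit_pair u w - \sum_(w | arrow w u) unit_pair w v
     - lam (blk u) *: \sum_(w | arrow u w) unit_pair w v).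
Proof. by case: u v => [i|j] [i'|j'] // _ _; exact: tangent_row. Qed.

(** Adding the tangent vectors of X = C E and Y = E C cancels the component in
    the first matrix and leaves (0, E C D - D C E).  This shift by two steps
    isolates the difference of the eigenvalues. *)
Lemma two_step u u' v v' : is_col u -> ~~ is_col v -> arrow u' u -> arrow v v' ->
  S (\sum_(w | arrow v' w) unit_pair u w - \sum_(w | arrow w u') unit_pair w v
     + (lam (blk v) - lam (blk u)) *: unit_pair u v).
Proof.
move=> cu cv u'u vv'.
have cv' : is_col v' by rewrite (arrow_col vv').
have cu' : ~~ is_col u' by rewrite -(arrow_col u'u).
have := SD (tangent_colv cu cv') (tangent_rowv cu' cv).
rewrite !(arrow_sum _ vv') !(prev_sum _ vv') !(arrow_sum _ u'u) !(prev_sum _ u'u).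
have -> : blk v' = blk v by case/andP: vv' => /eqP.
have -> : blk u' = blk u by case/andP: u'u => /eqP.
congr S; rewrite scalerBl !addrA.
by rewrite [LHS](ACl (1*5*3*6*(2*4))) /= addNr addr0.
Qed.

(** The Sylvester operator of two Jordan blocks with different eigenvalues is
    surjective: the shift by two steps expresses each unit through units nearer
    to the corner where the first chain begins and the second one ends. *)
Lemma distinct_lam u v : is_col u -> ~~ is_col v -> lam (blk u) != lam (blk v) ->
  S (unit_pair u v).
Proof.
have [k] := ubnP (pos u + (len (blk v) - pos v))%N.
elim: k u v => // k IH u v ltk cu cv luv.
have luv' : lam (blk v) - lam (blk u) != 0 by rewrite subr_eq0 eq_sym.
have Sv v' : arrow v v' -> S (\sum_(w | arrow v' w) unit_pair u w).
  move=> vv'; apply: S_sum => w v'w; move: (arrow_col v'w); rewrite (arrow_col vv').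
  rewrite negbK => cw.
  case/andP: vv' => /eqP bv /eqP pv; case/andP: v'w => /eqP bw /eqP pw.
  apply: IH; rewrite ?cw -?bw -?bv //; have := pos_lt w; rewrite -bw -bv; lia.
have Su u' : arrow u' u -> S (\sum_(w | arrow w u') unit_pair w v).
  move=> u'u; apply: S_sum => w wu'; move: (arrow_col u'u); rewrite (arrow_col wu').
  rewrite negbK => cw.
  case/andP: u'u => /eqP bu /eqP pu; case/andP: wu' => /eqP bw /eqP pw.
  by apply: IH; rewrite -?cw ?bw ?bu //; lia.
have [pu|pu] := posnP (pos u).
  have u0 : lam (blk u) = 0.
    apply/eqP/contraT => /lam_col/(_ cu)[w /andP[_ /eqP]]; lia.
  have [v' vv'] : exists v', arrow v v'.
    by apply: lam_row => //; move: luv'; rewrite u0 subr0.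
  have := tangent_colv cu (_ : is_col v').
  rewrite (arrow_col vv') => /(_ cv); rewrite (prev_sum0 _ pu) (prev_sum _ vv').
  have <- : blk v = blk v' by case/andP: vv' => /eqP.
  rewrite subr0 addrC => /(SDl (Sv _ vv')).
  by apply: SZI; move: luv'; rewrite u0 subr0.
have [u' u'u] := arrow_pred pu.
have [pv|pv] := eqVneq (pos v).+1 (len (blk v)).
  have v0 : lam (blk v) = 0.
    apply/eqP/contraT => /lam_row/(_ cv)[w /andP[/eqP bw /eqP pw]].
    by have := pos_lt w; rewrite -bw -pv; lia.
  have := tangent_rowv (_ : ~~ is_col u') cv.
  rewrite -(arrow_col u'u) => /(_ cu); rewrite (arrow_sum0 _ pv) (arrow_sum _ u'u).
  have -> : blk u' = blk u by case/andP: u'u => /eqP.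
  rewrite sub0r -opprD addrC => /SN; rewrite opprK => /(SDl (Su _ u'u)).
  by apply: SZI; move: luv'; rewrite v0 sub0r oppr_eq0.
have [v' vv'] : exists v', arrow v v'.
  by apply: arrow_succ; have := pos_lt v; lia.
have := two_step cu cv u'u vv'; rewrite addrC.
by move=> /(SDl (SB (Sv _ vv') (Su _ u'u))); exact: SZI.
Qed.

(** A nonzero eigenvalue makes C invertible on its chain, so the whole first
    matrix can be cleared at the cost of the second one. *)
Lemma reduce_to_col u v : ~~ is_col u -> is_col v ->
  (lam (blk u) != 0) || (lam (blk v) != 0) ->
  (forall u' v', is_col u' -> ~~ is_col v' -> blk u' = blk u -> blk v' = blk v ->
     S (unit_pair u' v')) ->
  S (unit_pair u v).
Proof.
move=> cu cv luv Suv.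
have blk_arrow w w' : arrow w w' -> blk w = blk w' by case/andP=> /eqP.
have [lu|lu] := boolP (lam (blk u) != 0).
  have [u' uu'] := lam_row lu cu.
  have cu' : is_col u' by rewrite (arrow_col uu').
  have := tangent_colv cu' cv; rewrite (prev_sum _ uu') addrAC => h.
  rewrite -[unit_pair u v]opprK; apply: SN; move: h; rewrite addrC; apply: SDl.
  apply: SD; last apply: SZ; apply: S_sum => w ww; apply: Suv => //.
  - by rewrite (arrow_col ww) cv.
  - by rewrite (blk_arrow _ _ uu').
  - by rewrite (blk_arrow _ _ ww).
  - by move: cv; rewrite (arrow_col ww).
  - by rewrite (blk_arrow _ _ uu').
  - by rewrite (blk_arrow _ _ ww).
move: luv; rewrite (negPf lu) /= => lv.
have [v' v'v] := lam_col lv cv.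
have cv' : ~~ is_col v' by rewrite -(arrow_col v'v).
have := tangent_rowv cu cv'; rewrite (arrow_sum _ v'v) -addrA; apply: SDl.
rewrite -opprD; apply: SN.
apply: SD; last apply: SZ; apply: S_sum => w ww; apply: Suv => //.
- by move: cu; rewrite (arrow_col ww) negbK.
- by rewrite (blk_arrow _ _ ww).
- by rewrite (blk_arrow _ _ v'v).
- by rewrite (arrow_col ww).
- by rewrite (blk_arrow _ _ ww).
- by rewrite (blk_arrow _ _ v'v).
Qed.

(* For equal nonzero eigenvalues only the second matrix remains, and two steps
   along the chains are one step along the Jordan blocks. *)
Section Arnold.
Variables (mu : K).
Hypothesis mu0 : mu != 0.

Let eigen u := lam (blk u) = mu.

Let eigen_arrow u v : arrow u v -> eigen u <-> eigen v.
Proof. by rewrite /eigen => /andP[/eqP->]. Qed.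

Let pos_arrow u v : arrow u v -> pos v = (pos u).+1.
Proof. by case/andP=> _ /eqP. Qed.

Let blk_arrow u v : arrow u v -> blk v = blk u.
Proof. by case/andP=> /eqP ->. Qed.

Let eigen_col u : eigen u -> is_col u -> odd (pos u).
Proof.
move=> eu cu; have [|su _] := @lam_even (blk u); first by rewrite eu.
by rewrite pos_odd cu (negPf su).
Qed.

Let eigen_row u : eigen u -> ~~ is_col u -> ~~ odd (pos u).
Proof.
move=> eu cu; have [|su _] := @lam_even (blk u); first by rewrite eu.
by rewrite pos_odd (negPf cu) (negPf su).
Qed.

Let eigen_len u : eigen u -> ~~ odd (len (blk u)).
Proof. by move=> eu; have [|] := @lam_even (blk u); rewrite ?eu. Qed.

Let arrow2_col u v w : arrow u v -> arrow v w -> is_col u = is_col w.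
Proof. by move=> /arrow_col uv /arrow_col ->; rewrite uv negbK. Qed.

Let two_step_eq u u' v v' : is_col u -> ~~ is_col v -> eigen u -> eigen v ->
  arrow u' u -> arrow v v' ->
  S (\sum_(w | arrow v' w) unit_pair u w - \sum_(w | arrow w u') unit_pair w v).
Proof.
move=> cu cv eu ev uu vv; have := two_step cu cv uu vv.
by rewrite eu ev subrr scale0r addr0.
Qed.

Lemma arnold_shift u0 u1 u v0 v1 v : is_col u -> ~~ is_col v -> eigen u -> eigen v ->
  arrow u0 u1 -> arrow u1 u -> arrow v0 v1 -> arrow v1 v ->
  S (unit_pair u v) <-> S (unit_pair u0 v0).
Proof.
move=> cu cv eu ev a b c d.
have cv0 : ~~ is_col v0 by rewrite (arrow2_col c d).
have ev0 : eigen v0 by apply/(eigen_arrow c)/(eigen_arrow d).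
have := two_step_eq cu cv0 eu ev0 b c; rewrite (arrow_sum _ d) (prev_sum _ a) => h.
split=> Suv; last first.
  by rewrite -(subrK (unit_pair u0 v0) (unit_pair u v)); exact: SD.
rewrite -[unit_pair u0 v0](subrK (unit_pair u v)); apply: SD => //.
by rewrite -opprB; exact: SN.
Qed.

Lemma arnold_above u v : is_col u -> ~~ is_col v -> eigen u -> eigen v ->
  (pos u < pos v)%N -> S (unit_pair u v).
Proof.
have [k] := ubnP (pos u); elim: k u v => // k IH u v ltk cu cv eu ev ltuv.
have [pu2 pv2] : (0 < pos u)%N /\ (1 < pos v)%N.
  have ou := eigen_col eu cu; clear -ou ltuv; lia.
have [v1 d] : exists v1, arrow v1 v by apply: arrow_pred; lia.
have [v0 c] : exists v0, arrow v0 v1 by apply: arrow_pred; have := pos_arrow d; lia.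
have [u1 b] : exists u1, arrow u1 u by apply: arrow_pred; lia.
have [pu1|pu1] := posnP (pos u1).
  have cv0 : ~~ is_col v0 by rewrite (arrow2_col c d).
  have ev0 : eigen v0 by apply/(eigen_arrow c)/(eigen_arrow d).
  have := two_step_eq cu cv0 eu ev0 b c.
  by rewrite (arrow_sum _ d) (prev_sum0 _ pu1) subr0.
have [u0 a] := arrow_pred pu1.
apply/(arnold_shift cu cv eu ev a b c d); apply: IH.
- by have := pos_arrow a; have := pos_arrow b; clear -ltk; lia.
- by rewrite (arrow2_col a b).
- by rewrite (arrow2_col c d).
- by apply/(eigen_arrow a)/(eigen_arrow b).
- by apply/(eigen_arrow c)/(eigen_arrow d).
- have := pos_arrow a; have := pos_arrow b; have := pos_arrow c; have := pos_arrow d.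
  clear -ltuv; lia.
Qed.

Lemma arnold_below u v : is_col u -> ~~ is_col v -> eigen u -> eigen v ->
  (pos u + len (blk v) < pos v + len (blk u))%N -> S (unit_pair u v).
Proof.
have [k] := ubnP (len (blk v) - pos v)%N.
elim: k u v => // k IH u v ltk cu cv eu ev ltuv.
have pv2 : ((pos v).+1 < len (blk v))%N.
  have ov := eigen_row ev cv; have lv := eigen_len ev; have := pos_lt v.
  clear -ov lv; lia.
have pu2 : ((pos u).+2 < len (blk u))%N by clear -pv2 ltuv; lia.
have [u1 a] : exists u1, arrow u u1 by apply: arrow_succ; lia.
have [u2 b] : exists u2, arrow u1 u2.
  by apply: arrow_succ; rewrite (pos_arrow a) (blk_arrow a); lia.
have [v1 c] : exists v1, arrow v v1 by apply: arrow_succ; lia.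
have cu2 : is_col u2 by rewrite -(arrow2_col a b).
have eu2 : eigen u2 by apply/(eigen_arrow b)/(eigen_arrow a).
have [pv1|pv1] := eqVneq (pos v1).+1 (len (blk v1)).
  have := two_step_eq cu2 cv eu2 ev b c.
  rewrite (arrow_sum0 _ pv1) (prev_sum _ a) sub0r => /SN; by rewrite opprK.
have [v2 d] : exists v2, arrow v1 v2.
  by apply: arrow_succ; have := pos_lt v1; lia.
have cv2 : ~~ is_col v2 by rewrite -(arrow2_col c d).
have ev2 : eigen v2 by apply/(eigen_arrow d)/(eigen_arrow c).
apply/(arnold_shift cu2 cv2 eu2 ev2 a b c d); apply: IH => //;
  rewrite (blk_arrow d) (blk_arrow c) ?(blk_arrow b) ?(blk_arrow a)
    (pos_arrow d) (pos_arrow c) ?(pos_arrow b) ?(pos_arrow a);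
  clear -ltk ltuv pv2; lia.
Qed.

Lemma arnold_diagonal u v u' v' : is_col u -> ~~ is_col v -> is_col u' ->
  eigen u -> eigen v ->
  blk u = blk u' -> blk v = blk v' -> (pos u' + pos v = pos u + pos v')%N ->
  S (unit_pair u' v') -> S (unit_pair u v).
Proof.
have [k] := ubnP ((pos u - pos u') + (pos u' - pos u))%N.
elim: k u v => // k IH u v ltk cu cv cu' eu ev bu bv pp Suv'.
have eu' : eigen u' by rewrite /eigen -bu.
have ou := eigen_col eu cu; have ov := eigen_row ev cv.
have ou' := eigen_col eu' cu'.
have pu' := pos_lt u'; have pv' := pos_lt v'; rewrite -bu -bv in pu' pv'.
have [ltu|ltu|equ] := ltngtP (pos u) (pos u').
- have ltu2 : ((pos u).+1 < pos u')%N by clear -ou ou' ltu; lia.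
  have [pu2 pv2] : ((pos u).+2 < len (blk u))%N /\ ((pos v).+2 < len (blk v))%N.
    by clear -ltu2 pp pu' pv'; lia.
  have [u1 a] : exists u1, arrow u u1 by apply: arrow_succ; exact: ltnW.
  have [u2 b] : exists u2, arrow u1 u2.
    by apply: arrow_succ; rewrite (pos_arrow a) (blk_arrow a).
  have [v1 c] : exists v1, arrow v v1 by apply: arrow_succ; exact: ltnW.
  have [v2 d] : exists v2, arrow v1 v2.
    by apply: arrow_succ; rewrite (pos_arrow c) (blk_arrow c).
  have cu2 : is_col u2 by rewrite -(arrow2_col a b).
  have eu2 : eigen u2 by apply/(eigen_arrow b)/(eigen_arrow a).
  have cv2 : ~~ is_col v2 by rewrite -(arrow2_col c d).
  have ev2 : eigen v2 by apply/(eigen_arrow d)/(eigen_arrow c).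
  apply/(arnold_shift cu2 cv2 eu2 ev2 a b c d); apply: IH => //;
    rewrite ?(blk_arrow d) ?(blk_arrow c) ?(blk_arrow b) ?(blk_arrow a) //
      ?(pos_arrow d) ?(pos_arrow c) ?(pos_arrow b) ?(pos_arrow a);
    clear -ltk pp ltu2; lia.
- have ltu2 : ((pos u').+1 < pos u)%N by clear -ou ou' ltu; lia.
  have ltv2 : (1 < pos v)%N by clear -ltu2 pp; lia.
  have [u1 b] : exists u1, arrow u1 u by apply: arrow_pred; exact: leq_ltn_trans ltu.
  have [u0 a] : exists u0, arrow u0 u1.
    by apply: arrow_pred; have := pos_arrow b; clear -ltu2; lia.
  have [v1 d] : exists v1, arrow v1 v by apply: arrow_pred; exact: ltnW.
  have [v0 c] : exists v0, arrow v0 v1.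
    by apply: arrow_pred; have := pos_arrow d; clear -ltv2; lia.
  apply/(arnold_shift cu cv eu ev a b c d); apply: IH => //.
  + have := pos_arrow a; have := pos_arrow b; clear -ltk ltu2; lia.
  + by rewrite (arrow2_col a b).
  + by rewrite (arrow2_col c d).
  + by apply/(eigen_arrow a)/(eigen_arrow b).
  + by apply/(eigen_arrow c)/(eigen_arrow d).
  + by rewrite -bu (blk_arrow b) (blk_arrow a).
  + by rewrite -bv (blk_arrow d) (blk_arrow c).
  + have := pos_arrow a; have := pos_arrow b; have := pos_arrow c; have := pos_arrow d.
    clear -pp; lia.
- have -> : u = u' by apply: pos_inj.
  by have -> : v = v' by apply: pos_inj => //; lia.
Qed.

End Arnold.

End Eigenvalues.

Variable star : rel vertex.
Hypothesis S_star : forall u v, star u v -> S (unit_pair u v).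
Hypothesis star_nilp : forall u v, star u v -> lam (blk v) != 0 -> is_col u.
Hypothesis star_ex : forall u v, is_col u != is_col v ->
  lam (blk u) = lam (blk v) -> (lam (blk v) != 0 -> is_col u) -> allowed u v ->
  exists u' v', [/\ star u' v', blk u = blk u', blk v = blk v' &
    (pos u' + pos v = pos u + pos v')%N].

Lemma equal_lam u v : is_col u != is_col v ->
  (lam (blk v) != 0 -> is_col u) -> lam (blk u) = lam (blk v) -> S (unit_pair u v).
Proof.
move=> uv cu luv.
have [al|nal] := boolP (allowed u v).
  have [u' [v' [st bu bv pp]]] := star_ex uv luv cu al.
  have [v0|v0] := eqVneq (lam (blk v)) 0.
    by apply: (nilpotent_diagonal uv _ v0 bu bv pp); rewrite ?luv //; exact: S_star.
  have := cu v0 => {}cu.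
  apply: (arnold_diagonal v0 cu _ _ luv erefl bu bv pp (S_star st)).
    by move: uv; rewrite cu; case: is_col.
  by apply: star_nilp st _; rewrite -bv.
have {}nal : (pos u < pos v)%N \/ (pos u + len (blk v) < pos v + len (blk u))%N.
  by move: nal; rewrite negb_and -!ltnNge => /orP.
have [v0|v0] := eqVneq (lam (blk v)) 0.
  have u0 : lam (blk u) = 0 by rewrite luv.
  by case: nal; [exact: nilpotent_above|exact: nilpotent_below].
have := cu v0 => {}cu.
have cv : ~~ is_col v by move: uv; rewrite cu; case: is_col.
by case: nal; [exact: (arnold_above v0)|exact: (arnold_below v0)].
Qed.

Lemma unit_pair_spanned u v : is_col u != is_col v -> S (unit_pair u v).
Proof.
move=> uv.
have col_row u1 v1 : is_col u1 -> ~~ is_col v1 -> S (unit_pair u1 v1).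
  move=> cu cv; have [luv|luv] := eqVneq (lam (blk u1)) (lam (blk v1)).
    by apply: equal_lam => //; rewrite cu (negPf cv).
  exact: distinct_lam.
have [cu|cu] := boolP (is_col u).
  by apply: col_row => //; move: uv; rewrite cu; case: is_col.
have cv : is_col v by move: uv; rewrite (negPf cu); case: is_col.
have [luv|] := boolP ((lam (blk u) != 0) || (lam (blk v) != 0)).
  by apply: reduce_to_col => // u' v' cu' cv' _ _; exact: col_row.
rewrite negb_or !negbK => /andP[/eqP u0 /eqP v0].
by apply: equal_lam => //; rewrite ?v0 ?eqxx // u0.
Qed.

Lemma all_spanned E : S E.
Proof.
case: E => E1 E2; have -> : (E1, E2) =
    \sum_i \sum_j E1 i j *: unit_pair (inl i) (inr j)
    + \sum_j \sum_i E2 j i *: unit_pair (inr j) (inl i).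
  have sc1 (a : K) (A : 'M[K]_(m, n)) :
    a *: (A, 0 : 'M[K]_(n, m)) = (a *: A, 0) by congr pair; rewrite scaler0.
  have sc2 (a : K) (A : 'M[K]_(n, m)) :
    a *: (0 : 'M[K]_(m, n), A) = (0, a *: A) by congr pair; rewrite scaler0.
  under eq_bigr do under eq_bigr do rewrite /= sc1.
  under [X in _ + X]eq_bigr do under eq_bigr do rewrite /= sc2.
  under eq_bigr do rewrite sum_pair big1_eq.
  under [X in _ + X]eq_bigr do rewrite sum_pair big1_eq.
  rewrite !sum_pair !big1_eq.
  by congr pair; rewrite /= ?addr0 ?add0r; exact: matrix_sum_delta.
apply: SD; apply: S_sum => i _; apply: S_sum => j _; apply: SZ;
  exact: unit_pair_spanned.
Qed.

End Spanning.

(** ** The stars are independent modulo the tangent space *)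

Section Functional.
Variables u0 v0 : vertex.
Hypothesis lam_uv0 : lam (blk u0) = lam (blk v0).
Hypothesis allowed_uv0 : allowed u0 v0.

(** The coefficients of the linear form that sums the entries of a pair along
    the diagonal of [(u0, v0)].  For a nonzero eigenvalue the form is the one
    that takes (E1, E2) to the sum, along a diagonal, of E2 + E1 J, which
    accounts for the second summand. *)
Definition psi (u v : vertex) : K :=
  ((blk u == blk u0) && (blk v == blk v0))%:R *
  ((pos v + pos u0 == pos u + pos v0)%N%:R +
   ((~~ is_col u) && (pos v + pos u0 == pos u + pos v0 + 2)%N)%:R * lam (blk v0)).

Let arrow_sumP u (g : vertex -> K) :
  (exists2 w, arrow u w & \sum_(w | arrow u w) g w = g w) \/
  ((pos u).+1 = len (blk u) /\ \sum_(w | arrow u w) g w = 0).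
Proof.
have [e|e] := eqVneq (pos u).+1 (len (blk u)).
  by right; rewrite arrow_sum0.
have [w uw] : exists w, arrow u w by apply: arrow_succ; have := pos_lt u; lia.
by left; exists w; rewrite ?(arrow_sum _ uw).
Qed.

Let prev_sumP u (g : vertex -> K) :
  (exists2 w, arrow w u & \sum_(w | arrow w u) g w = g w) \/
  (pos u = 0%N /\ \sum_(w | arrow w u) g w = 0).
Proof.
have [e|e] := posnP (pos u); first by right; rewrite prev_sum0.
have [w uw] := arrow_pred e.
by left; exists w; rewrite ?(prev_sum _ uw).
Qed.

Let psi0 u v : (blk u == blk u0) && (blk v == blk v0) = false -> psi u v = 0.
Proof. by rewrite /psi => ->; rewrite mul0r. Qed.

Let psi_in u v : blk u = blk u0 -> blk v = blk v0 -> psi u v =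
  (pos v + pos u0 == pos u + pos v0)%N%:R +
   ((~~ is_col u) && (pos v + pos u0 == pos u + pos v0 + 2)%N)%:R * lam (blk v0).
Proof. by rewrite /psi => -> ->; rewrite !eqxx mul1r. Qed.

(** The form vanishes on the tangent vector of an elementary X.  Only the ends of
    the chains are at stake, and [allowed] says that the diagonal meets neither
    end prematurely. *)
Lemma psi_row u v : ~~ is_col u -> ~~ is_col v ->
  \sum_(w | arrow v w) psi u w =
  \sum_(w | arrow w u) psi w v + lam (blk u) * \sum_(w | arrow u w) psi w v.
Proof.
move=> cu cv.
have [/andP[/eqP bu /eqP bv]|buv] :=
  boolP ((blk u == blk u0) && (blk v == blk v0)); last first.
  rewrite !big1 ?mulr0 ?addr0 // => w /andP[/eqP bw _]; apply: psi0.
  - by rewrite -bw; exact: negbTE.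
  - by rewrite bw; exact: negbTE.
  - by rewrite -bw; exact: negbTE.
have /andP[al1 al2] := allowed_uv0.
have lu := pos_lt u; have lv := pos_lt v.
rewrite bu in lu; rewrite bv in lv.
(* Neither side is cut short by the end of a chain. *)
have first : (\sum_(w | arrow v w) (pos w + pos u0 == pos u + pos v0)%N%:R : K) =
    \sum_(w | arrow w u) (pos v + pos u0 == pos w + pos v0)%N%:R.
  have [[w /andP[_ /eqP pw] ->]|[pv ->]] :=
    arrow_sumP v (fun w => (pos w + pos u0 == pos u + pos v0)%N%:R);
  have [[x /andP[_ /eqP px] ->]|[pu ->]] :=
    prev_sumP u (fun w => (pos v + pos u0 == pos w + pos v0)%N%:R).
  - by congr ((nat_of_bool _)%:R); apply/eqP/eqP; lia.
  - by case: eqP => // e; exfalso; lia.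
  - by rewrite bv in pv; case: eqP => // e; exfalso; lia.
  - by [].
have second : lam (blk v0) *
      (\sum_(w | arrow v w) (pos w + pos u0 == pos u + pos v0 + 2)%N%:R) =
    lam (blk u) * \sum_(w | arrow u w) (pos v + pos u0 == pos w + pos v0)%N%:R :> K.
  rewrite bu lam_uv0; have [->|l0] := eqVneq (lam (blk v0)) 0; first by rewrite !mul0r.
  have [w vw] : exists w, arrow v w by apply: lam_row; rewrite ?bv.
  have [x ux] : exists x, arrow u x by apply: lam_row; rewrite ?bu ?lam_uv0.
  rewrite (arrow_sum _ vw) (arrow_sum _ ux); congr (_ * (nat_of_bool _)%:R).
  by move: vw ux => /andP[_ /eqP ->] /andP[_ /eqP ->]; apply/eqP/eqP; lia.
transitivity (\sum_(w | arrow v w) (pos w + pos u0 == pos u + pos v0)%N%:R +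
   lam (blk v0) *
     (\sum_(w | arrow v w) (pos w + pos u0 == pos u + pos v0 + 2)%N%:R)).
  rewrite mulr_sumr -big_split; apply: eq_bigr => w /andP[/eqP bw _] /=.
  by rewrite psi_in // -?bw // cu /= mulrC.
rewrite first second; congr (_ + _ * _); apply: eq_bigr => w nw.
  rewrite psi_in //.
    by rewrite -[is_col w]negbK -(arrow_col nw) (negPf cu) /= mul0r addr0.
  by case/andP: nw => /eqP ->.
rewrite psi_in //; first by rewrite (arrow_col nw) cu /= mul0r addr0.
by case/andP: nw => /eqP <-.
Qed.

Lemma psi_col u v : is_col u -> is_col v ->
  \sum_(w | arrow v w) psi u w + lam (blk v) * \sum_(w | arrow w v) psi u w =
  \sum_(w | arrow w u) psi w v.
Proof.
move=> cu cv.
have [/andP[/eqP bu /eqP bv]|buv] :=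
  boolP ((blk u == blk u0) && (blk v == blk v0)); last first.
  rewrite !big1 ?mulr0 ?addr0 // => w /andP[/eqP bw _]; apply: psi0.
  - by rewrite bw; exact: negbTE.
  - by rewrite bw; exact: negbTE.
  - by rewrite -bw; exact: negbTE.
have /andP[al1 al2] := allowed_uv0.
have lu := pos_lt u; have lv := pos_lt v.
rewrite bu in lu; rewrite bv in lv.
(* Neither side is cut short by the end of a chain. *)
have first : (\sum_(w | arrow v w) (pos w + pos u0 == pos u + pos v0)%N%:R : K) =
    \sum_(w | arrow w u) (pos v + pos u0 == pos w + pos v0)%N%:R.
  have [[w /andP[_ /eqP pw] ->]|[pv ->]] :=
    arrow_sumP v (fun w => (pos w + pos u0 == pos u + pos v0)%N%:R);
  have [[x /andP[_ /eqP px] ->]|[pu ->]] :=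
    prev_sumP u (fun w => (pos v + pos u0 == pos w + pos v0)%N%:R).
  - by congr ((nat_of_bool _)%:R); apply/eqP/eqP; lia.
  - by case: eqP => // e; exfalso; lia.
  - by rewrite bv in pv; case: eqP => // e; exfalso; lia.
  - by [].
have second :
    lam (blk v) * (\sum_(w | arrow w v) (pos w + pos u0 == pos u + pos v0)%N%:R) =
    lam (blk v0) *
      \sum_(w | arrow w u) (pos v + pos u0 == pos w + pos v0 + 2)%N%:R :> K.
  rewrite bv; have [->|l0] := eqVneq (lam (blk v0)) 0; first by rewrite !mul0r.
  have [w vw] : exists w, arrow w v by apply: lam_col; rewrite ?bv.
  have [x ux] : exists x, arrow x u by apply: lam_col; rewrite ?bu ?lam_uv0.
  rewrite (prev_sum _ vw) (prev_sum _ ux); congr (_ * (nat_of_bool _)%:R).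
  by move: vw ux => /andP[_ /eqP ->] /andP[_ /eqP ->]; apply/eqP/eqP; lia.
transitivity (\sum_(w | arrow w u) (pos v + pos u0 == pos w + pos v0)%N%:R +
   lam (blk v0) *
     (\sum_(w | arrow w u) (pos v + pos u0 == pos w + pos v0 + 2)%N%:R));
  last first.
  rewrite mulr_sumr -big_split; apply: eq_bigr => w nw /=.
  rewrite psi_in //; last by case/andP: nw => /eqP ->.
  by rewrite -(arrow_col nw) cu mulrC.
rewrite -first -second; congr (_ + _ * _); apply: eq_bigr => w /andP[/eqP bw _].
  by rewrite psi_in -?bw // cu /= mul0r addr0.
by rewrite psi_in ?bw // cu /= mul0r addr0.
Qed.

Definition psi_mxA : 'M[K]_(n, m) := \matrix_(j, i) psi (inl i) (inr j).
Definition psi_mxB : 'M[K]_(m, n) := \matrix_(i, j) psi (inr j) (inl i).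

Let sum_vertex (P : pred vertex) (g : vertex -> K) :
  \sum_(w | P w) g w =
  \sum_i (P (inl i))%:R * g (inl i) + \sum_j (P (inr j))%:R * g (inr j).
Proof.
rewrite big_sumType [X in X + _ = _]big_mkcond [X in _ + X = _]big_mkcond /=.
by congr (_ + _); apply: eq_bigr => i _; case: (P _); rewrite ?mul1r ?mul0r.
Qed.

Let arrow_same u v : is_col u = is_col v -> arrow u v = false.
Proof. by move=> c; apply/negP => /arrow_col; rewrite c; case: is_col. Qed.

(** The pairs that intertwine C and D in this way form the annihilator of the
    tangent space under the trace form. *)
Lemma psi_mx_comm : C *m psi_mxA = psi_mxB *m D /\ D *m psi_mxB = psi_mxA *m C.
Proof.
split; apply/matrixP => i i'; rewrite !mxE.
  have := @psi_row (inl i') (inl i) isT isT; rewrite !sum_vertex.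
  have nl k k' : arrow (inl k) (inl k') = false by apply: arrow_same.
  under eq_bigr do rewrite nl mul0r.
  under [X in _ = X + _ + _]eq_bigr do rewrite nl mul0r.
  under [X in _ = _ + _ * (X + _)]eq_bigr do rewrite nl mul0r.
  rewrite !big1_eq !add0r.
  move=> h; under eq_bigr do rewrite C_arrow !mxE; rewrite h mulr_sumr -big_split.
  by apply: eq_bigr => k _; rewrite D_arrow !mxE /=; ring.
have := @psi_col (inr i') (inr i) isT isT; rewrite !sum_vertex.
have nr k k' : arrow (inr k) (inr k') = false by apply: arrow_same.
under [X in _ + X + _]eq_bigr do rewrite nr mul0r.
under [X in _ + _ * (_ + X)]eq_bigr do rewrite nr mul0r.
under [X in _ = _ + X]eq_bigr do rewrite nr mul0r.
rewrite !big1_eq !addr0.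
move=> h; under [RHS]eq_bigr do rewrite C_arrow !mxE mulrC.
rewrite -h mulr_sumr -big_split.
apply: eq_bigr => k _; rewrite D_arrow !mxE /=.
case: (boolP (arrow (inl k) (inr i))) => [/andP[/eqP-> _]|_] /=;
  by rewrite ?mulr1n ?mulr0n; ring.
Qed.

Lemma psi_tangent X Y :
  \tr ((X *m C - C *m Y) *m psi_mxA) + \tr ((Y *m D - D *m X) *m psi_mxB) = 0.
Proof.
have [e1 e2] := psi_mx_comm.
rewrite !mulmxBl !raddfB /= -!mulmxA e1 e2 [\tr (C *m _)]mxtrace_mulC.
by rewrite [\tr (D *m _)]mxtrace_mulC -!mulmxA addrA subrK subrr.
Qed.

End Functional.

(** ** Transversality for chains *)

Section Transversal.
Variables (k : nat) (f : 'I_k -> entry m n).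

Definition source (x : entry m n) : vertex :=
  match x with inl ij => inl ij.1 | inr ji => inr ji.1 end.
Definition target (x : entry m n) : vertex :=
  match x with inl ij => inr ij.2 | inr ji => inl ji.2 end.
Local Notation bs x := (blk (source x)).
Local Notation bt x := (blk (target x)).
Local Notation ps x := (pos (source x)).
Local Notation pt x := (pos (target x)).

Hypothesis f_lam : forall t, lam (bs (f t)) = lam (bt (f t)).
Hypothesis f_allowed : forall t, allowed (source (f t)) (target (f t)).
Hypothesis f_col : forall t, lam (bt (f t)) != 0 -> is_col (source (f t)).
Hypothesis f_uniq : forall t t', bs (f t) = bs (f t') -> bt (f t) = bt (f t') ->
  (pt (f t) + ps (f t') = ps (f t) + pt (f t'))%N -> t = t'.
Hypothesis f_ex : forall x, lam (bs x) = lam (bt x) ->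
  (lam (bt x) != 0 -> is_col (source x)) -> allowed (source x) (target x) ->
  exists t, [/\ bs x = bs (f t), bt x = bt (f t) &
    (ps (f t) + pt x = ps x + pt (f t))%N].

Lemma param_delta t : (paramA f (delta_mx 0 t) : 'M[K]_(m, n), paramB f (delta_mx 0 t)) =
  unit_pair (source (f t)) (target (f t)).
Proof.
have sum_delta y : \sum_(s < k | f s == y) (delta_mx 0 t : 'rV[K]_k) 0 s = (f t == y)%:R.
  rewrite big_mkcond (bigD1 t) //= big1 => [|s st]; last first.
    by rewrite !mxE (negPf st) andbF; case: ifP.
  by rewrite !mxE !eqxx addr0; case: eqP.
have inlE a b c d : (inl (a, b) == inl (c, d) :> entry m n) = (c == a) && (d == b).
  by rewrite (eq_sym c) (eq_sym d).
have inrE a b c d : (inr (a, b) == inr (c, d) :> entry m n) = (c == a) && (d == b).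
  by rewrite (eq_sym c) (eq_sym d).
case ft: (f t) => [[i j]|[j i]]; congr pair; apply/matrixP => a b;
  by rewrite !mxE sum_delta ft ?inlE ?inrE.
Qed.

Lemma chains_spanning : spanning C D f.
Proof.
pose S (E : 'M[K]_(m, n) * 'M[K]_(n, m)) := exists (X : 'M_m) (Y : 'M_n) a,
  E = (X *m C - C *m Y + paramA f a, Y *m D - D *m X + paramB f a).
pose star u v := [exists t, (source (f t) == u) && (target (f t) == v)].
move=> E; apply: (@all_spanned S _ _ _ _ star); clear E.
- exists 0, 0, 0; by rewrite !linear0 ?mul0mx ?mulmx0 ?subrr ?addr0.
- move=> _ _ [X [Y [a ->]]] [X' [Y' [a' ->]]]; exists (X + X'), (Y + Y'), (a + a').
  rewrite !linearD /= !mulmxDl ?mulmxDr ?opprD; congr pair.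
    by rewrite /= !addrA [LHS](ACl (1*4*2*5*3*6)).
  by rewrite /= !addrA [LHS](ACl (1*4*2*5*3*6)).
- move=> b _ [X [Y [a ->]]]; exists (b *: X), (b *: Y), (b *: a).
  rewrite !linearZ /= -?scalemxAl -?scalemxAr.
  by congr pair; rewrite /= !scalerDr !scalerN.
- by move=> X Y; exists X, Y, 0; rewrite !linear0 !addr0.
- move=> u v /existsP[t /andP[/eqP <- /eqP <-]].
  exists 0, 0, (delta_mx 0 t).
  by rewrite !mul0mx !mulmx0 !subrr !add0r param_delta.
- by move=> u v /existsP[t /andP[/eqP <- /eqP <-]]; exact: f_col.
- move=> u v uv luv cu al.
  have [x [xu xv]] : exists x, source x = u /\ target x = v.
    by case: u v uv {luv cu al} => [i|j] [i'|j'] // _;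
      [exists (inl (i, j'))|exists (inr (j, i'))].
  have := @f_ex x; rewrite xu xv => /(_ luv cu al)[t [e1 e2 e3]].
  exists (source (f t)), (target (f t)); split=> //.
  by apply/existsP; exists t; rewrite !eqxx.
Qed.

Lemma trace_delta a b (i : 'I_a) (j : 'I_b) (M : 'M[K]_(b, a)) :
  \tr (delta_mx i j *m M) = M j i.
Proof.
rewrite delta_mulmx linear_sum (bigD1 i) //= big1 => [|s si];
  rewrite linearZ /= /mxtrace.
  rewrite addr0 (bigD1 i) //= big1 => [|s si].
    by rewrite !mxE ?eqxx ?addr0 ?mulr1.
  by rewrite !mxE (negPf si).
rewrite big1 ?mulr0 // => x _; rewrite !mxE.
by case: (eqVneq x i) => //= ->; rewrite eq_sym (negPf si).
Qed.

(** The linear form of the diagonal of one star vanishes on all the others, since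
    no two stars share a diagonal; so it reads off the parameter of that
    star. *)
Lemma chains_independent : independent C D f.
Proof.
move=> X Y a eA eB; apply/rowP => t; rewrite mxE.
have := psi_tangent (f_lam t) (f_allowed t) X Y; rewrite -eA -eB => <-.
set Z := psi_mxA _ _; set W := psi_mxB _ _.
pose phi (E : 'M[K]_(m, n) * 'M[K]_(n, m)) := \tr (E.1 *m Z) + \tr (E.2 *m W).
have phiE s : phi (paramA f (delta_mx 0 s), paramB f (delta_mx 0 s)) = (s == t)%:R.
  rewrite param_delta.
  have -> : phi (unit_pair (source (f s)) (target (f s))) =
      psi (source (f t)) (target (f t)) (source (f s)) (target (f s)).
    by case: (f s) => -[i j]; rewrite /phi /= trace_delta mxE mul0mx mxtrace0
      ?addr0 ?add0r.
  have [->|st] := eqVneq s t.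
    rewrite /psi !eqxx mul1r addnC eqxx.
    case: eqP => [|_]; first by lia.
    by rewrite andbF mul0r addr0.
  rewrite /psi; case: eqP => [b1|]; last by rewrite mul0r.
  case: eqP => [b2|]; last by rewrite mul0r.
  case: eqP => [e|_].
    by case/eqP: st; apply: f_uniq b1 b2 _.
  rewrite mul1r add0r; have [->|l0] := eqVneq (lam (bt (f t))) 0.
    by rewrite mulr0.
  by rewrite f_col ?b2 // mul0r.
have -> : \tr (paramA f a *m Z) + \tr (paramB f a *m W) =
    \sum_s a 0 s * phi (paramA f (delta_mx 0 s), paramB f (delta_mx 0 s)).
  rewrite {1 2}[a]row_sum_delta !linear_sum !mulmx_suml !linear_sum -big_split.
  by apply: eq_bigr => s _; rewrite !linearZ /= -!scalemxAl !linearZ /= -mulrDr.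
rewrite (bigD1 t) //= phiE eqxx mulr1 big1 ?addr0 // => s st.
by rewrite phiE (negPf st) mulr0.
Qed.

End Transversal.

End Chains.

(** * Coordinates in direct sums *)

Section Coordinates.

(** A numbering of the pairs (a, k) with k < dim a: in the applications [a] is a
    summand of a direct sum and [k] an index inside it. *)
Definition coordinates (A : Type) (dim : A -> nat) (N : nat)
    (f : 'I_N -> A * nat) : Prop :=
  [/\ forall i, ((f i).2 < dim (f i).1)%N, injective f &
      forall a k, (k < dim a)%N -> exists i, f i = (a, k)].

Definition block_coord (s : nat) (p : 'I_s -> nat) (i : 'I_(\sum_j p j)) :
    'I_s * nat :=
  (tagnat.sig1 i, val (tagnat.sig2 i)).

Definition nested_coord (s : nat) (t : 'I_s -> nat)
    (p : forall a, 'I_(t a) -> nat) (i : 'I_(\sum_a \sum_j p a j)) :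
    {a : 'I_s & 'I_(t a)} * nat :=
  let x := block_coord (tagnat.sig2 i) in (Tagged _ x.1, x.2).

Definition sum_coord (A B : Type) (M N : nat) (f : 'I_M -> A * nat)
    (g : 'I_N -> B * nat) (i : 'I_(M + N)) : (A + B) * nat :=
  match fintype.split i with
  | inl j => (inl (f j).1, (f j).2)
  | inr j => (inr (g j).1, (g j).2)
  end.

Lemma block_coordinates s (p : 'I_s -> nat) : coordinates p (@block_coord s p).
Proof.
split=> [i|i j|a k ka]; first exact: ltn_ord.
  move=> [e1 e2]; apply/val_inj/eqP.
  rewrite -[in eqbLHS](tagnat.sig2K i) -[in eqbRHS](tagnat.sig2K j) tagnat.eq_Rank.
  by apply/andP; split; apply/eqP.
exists (tagnat.Rank _ (Ordinal ka)); rewrite /block_coord tagnat.Rank2K /=.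
by congr pair; exact: tagnat.Rank1K.
Qed.

Lemma nested_coordinates s (t : 'I_s -> nat) (p : forall a, 'I_(t a) -> nat) :
  coordinates (fun b : {a : 'I_s & 'I_(t a)} => p (tag b) (tagged b))
    (@nested_coord s t p).
Proof.
pose rk a (x : 'I_(\sum_j p a j)) := @tagnat.Rank s (fun a => \sum_j p a j)%N a x.
split=> [i|i j|[a x] k ka]; first exact: ltn_ord.
  have Rank_inj : forall a b (x : 'I_(\sum_j p a j)) (y : 'I_(\sum_j p b j)),
      Tagged (fun a => 'I_(t a)) (block_coord x).1 = Tagged _ (block_coord y).1 ->
      (block_coord x).2 = (block_coord y).2 -> rk a x = rk b y.
    move=> a b x y e1; have ab : a = b := congr1 tag e1; case: b / ab y e1 => y.
    move=> /eqP; rewrite eq_Tagged => /eqP /= e1 e2; congr (rk _ _).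
    by have [_ inj _] := block_coordinates (p a); apply: inj; congr pair.
  move=> e; rewrite -(tagnat.sig2K i) -(tagnat.sig2K j).
  exact: (Rank_inj _ _ _ _ (congr1 fst e) (congr1 snd e)).
have [_ _ surj] := block_coordinates (p a); have [y yE] := surj x k ka.
exists (rk a y); rewrite /nested_coord.
have -> : tagnat.sig2 (rk a y) =
    cast_ord (congr1 (fun a => \sum_j p a j) (esym (tagnat.Rank1K y))) y.
  by rewrite tagnat.Rank2K; apply: val_inj.
move: (esym (tagnat.Rank1K y)); move: (tagnat.sig1 _) => b ab.
by case: b / ab; rewrite cast_ord_id yE.
Qed.

Lemma sum_coordinates A B (d : A -> nat) (e : B -> nat) M N
    (f : 'I_M -> A * nat) (g : 'I_N -> B * nat) :
  coordinates d f -> coordinates e g ->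
  coordinates (fun c => match c with inl a => d a | inr b => e b end)
    (sum_coord f g).
Proof.
move=> [fd finj fsurj] [gd ginj gsurj]; split=> [i|i j|[a|b] k].
- by rewrite /sum_coord; case: (fintype.split i).
- rewrite /sum_coord; case: (splitP i) => i' ii'; case: (splitP j) => j' jj' //= [e1 e2].
    apply/val_inj; rewrite /= ii' jj' (finj i' j') //.
    by case: (f i') (f j') e1 e2 => ? ? [? ?] /= -> ->.
  apply/val_inj; rewrite /= ii' jj' (ginj i' j') //.
  by case: (g i') (g j') e1 e2 => ? ? [? ?] /= -> ->.
- move=> /fsurj[i fi]; exists (lshift N i).
  by rewrite /sum_coord (unsplitK (inl i)) fi.
- move=> /gsurj[i gi]; exists (rshift M i).
  by rewrite /sum_coord (unsplitK (inr i)) gi.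
Qed.

Definition described (X A B : Type) (m n : nat) (M : 'M[X]_(m, n))
    (f : 'I_m -> A * nat) (g : 'I_n -> B * nat) (F : A * nat -> B * nat -> X) :=
  forall i j, M i j = F (f i) (g j).

Lemma described_block (X A A' B B' : Type) m1 m2 n1 n2
    (Mul : 'M[X]_(m1, n1)) Mur Mdl (Mdr : 'M[X]_(m2, n2))
    (f : 'I_m1 -> A * nat) (f' : 'I_m2 -> A' * nat)
    (g : 'I_n1 -> B * nat) (g' : 'I_n2 -> B' * nat) F :
  described Mul f g (fun x y => F (inl x.1, x.2) (inl y.1, y.2)) ->
  described Mur f g' (fun x y => F (inl x.1, x.2) (inr y.1, y.2)) ->
  described Mdl f' g (fun x y => F (inr x.1, x.2) (inl y.1, y.2)) ->
  described Mdr f' g' (fun x y => F (inr x.1, x.2) (inr y.1, y.2)) ->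
  described (block_mx Mul Mur Mdl Mdr) (sum_coord f f') (sum_coord g g') F.
Proof.
move=> ul ur dl dr i j; rewrite /sum_coord !mxE.
by case: (fintype.split i) => i'; rewrite !mxE; case: (fintype.split j) => j'.
Qed.

Lemma described_0 (X : nmodType) A B m n (f : 'I_m -> A * nat) (g : 'I_n -> B * nat) F :
  (forall i j, F (f i) (g j) = 0) -> described (0 : 'M[X]_(m, n)) f g F.
Proof. by move=> F0 i j; rewrite mxE F0. Qed.

Lemma described_1 (X : pzSemiRingType) (A : eqType) dim m (f : 'I_m -> A * nat) F :
  coordinates dim f -> (forall x y, F x y = (x == y)%:R) ->
  described (1%:M : 'M[X]_m) f f F.
Proof. by move=> [_ finj _] FE i j; rewrite !mxE FE (inj_eq finj). Qed.

Lemma described_mxblock X s t (p : 'I_s -> nat) (q : 'I_t -> nat)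
    (M : forall i j, 'M[X]_(p i, q j)) F :
  (forall i j x y, M i j x y = F (i, val x) (j, val y)) ->
  described (\mxblock_(i, j) M i j) (@block_coord _ p) (@block_coord _ q) F.
Proof. by move=> MF i j; rewrite mxE MF. Qed.

(** [conform_mx] is a cast between the sizes at i and at j, which disappears once
    the equation i = j is eliminated; [G] describes the entries for
    independent i and j, so that this elimination is possible. *)
Lemma dsum_entry (X : nmodType) s (p q : 'I_s -> nat)
    (M : forall i, 'M[X]_(p i, q i)) i j (x : 'I_(p i)) (y : 'I_(q j))
    (G : forall i j, 'I_(p i) -> 'I_(q j) -> X) :
  (forall i x y, M i x y = G i i x y) ->
  (forall i j x y, i != j -> G i j x y = 0) ->
  (if i == j then conform_mx 0 (M i) else 0 : 'M[X]_(p i, q j)) x y = G i j x y.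
Proof.
move=> MG G0; case: eqVneq => [e|ij]; last by rewrite mxE G0.
by case: j / e y => y; rewrite conform_mx_id.
Qed.

Lemma described_dsum (X : nmodType) s (p q : 'I_s -> nat)
    (M : forall i, 'M[X]_(p i, q i)) F :
  (forall i x y, M i x y = F (i, val x) (i, val y)) ->
  (forall i j k k', i != j -> F (i, k) (j, k') = 0) ->
  described (dsum M) (@block_coord _ p) (@block_coord _ q) F.
Proof.
move=> MF F0; apply: described_mxblock => i j x y.
by apply: (dsum_entry _ _ (G := fun i j x y => F (i, val x) (j, val y))) => // *; exact: F0.
Qed.

Lemma described_nested (X : nmodType) s (t : 'I_s -> nat)
    (p : forall a, 'I_(t a) -> nat) (M : forall a, 'M[X]_(\sum_i p a i)) F :
  (forall a, described (M a) (@block_coord _ (p a)) (@block_coord _ (p a))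
     (fun x y => F (Tagged _ x.1, x.2) (Tagged _ y.1, y.2))) ->
  (forall x y, tag x.1 != tag y.1 -> F x y = 0) ->
  described (\mxdiag_a M a) (@nested_coord _ _ p) (@nested_coord _ _ p) F.
Proof.
move=> MF F0 i j; rewrite mxE.
pose G a b (x : 'I_(\sum_i p a i)) (y : 'I_(\sum_i p b i)) :=
  F (Tagged (fun a => 'I_(t a)) (block_coord x).1, (block_coord x).2)
    (Tagged (fun a => 'I_(t a)) (block_coord y).1, (block_coord y).2).
by apply: (dsum_entry _ _ (G := G)) => [a x y|a b x y ab]; [exact: MF|exact: F0].
Qed.

End Coordinates.

(** * The star patterns of the canonical pair *)

Section StarPatterns.
Local Open Scope nat_scope.

Definition star_none (p q i j : nat) := false.
Definition star_top (p q i j : nat) := (0 < i) && star p.-1 q i.-1 j.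
Definition star_right (p q i j : nat) := (j < q.-1) && star p q.-1 i j.

Lemma star_inj p q i j i' j' : i < p -> i' < p -> j < q -> j' < q ->
  star p q i j -> star p q i' j' -> i + j' = i' + j -> i = i' /\ j = j'.
Proof.
rewrite /star; case: (ltnP p q) => pq; do 4!move=> _; move=> /eqP e /eqP e' E;
  by split; lia.
Qed.

(** The pattern meets every diagonal running from the first column to the last
    row.  A diagonal is given by the positions u and v, in their chains, of the
    two vertices of any of its entries; row i and column j stand at the
    positions 2 i + a and 2 j + b. *)
Lemma star_hits p q u v a b : ~~ odd (u + v + a + b) ->
  v + a <= u + b -> v + a + p.*2 <= u + b + q.*2 -> u + b < v + a + p.*2 ->
  exists i j, [/\ i < p, j < q, star p q i j & (i.*2 + a) + v = u + (j.*2 + b)].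
Proof.
move=> o h1 h2 h3.
(* The diagonal lies d places below the main one of the block. *)
pose d := (u + b - (v + a))./2.
have dE : u + b = v + a + d.*2 by rewrite /d; lia.
clearbody d; case: (ltnP p q) => pq.
  by exists d, 0; rewrite /star pq; split=> //; clear o; lia.
exists p.-1, (p.-1 - d); rewrite /star ifN -?leqNgt //.
by clear o; split; [lia|lia|apply/eqP; lia|lia].
Qed.

(** The zero row at the top shifts the remaining rows by one, that is, their
   positions by two. *)
Lemma star_top_hits p q u v a b : ~~ odd (u + v + a + b) ->
  v + a.+2 <= u + b -> v + a + p.*2 <= u + b + q.*2 -> u + b < v + a + p.*2 ->
  exists i j, [/\ i < p, j < q, star_top p q i j & (i.*2 + a) + v = u + (j.*2 + b)].
Proof.
move=> o h1 h2 h3.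
have [||||i [j [ip jq st e]]] := @star_hits p.-1 q u v a.+2 b.
- by rewrite !addnS /= negbK.
- by [].
- by clear o; lia.
- by clear o; lia.
by exists i.+1, j; rewrite /star_top /=; clear o; split=> //; lia.
Qed.

Lemma star_right_hits p q u v a b : ~~ odd (u + v + a + b) ->
  v + a <= u + b -> v + a + p.*2 <= u + b + q.-1.*2 -> u + b < v + a + p.*2 ->
  exists i j, [/\ i < p, j < q, star_right p q i j & (i.*2 + a) + v = u + (j.*2 + b)].
Proof.
move=> o h1 h2 h3; have [i [j [ip jq st e]]] := star_hits o h1 h2 h3.
by exists i, j; rewrite /star_right jq; clear o; split=> //; lia.
Qed.

End StarPatterns.

Section Canonical.
Variables (tau : nat) (t : 'I_tau -> nat) (n : forall a : 'I_tau, 'I_(t a) -> nat).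
Variables (l : nat) (p : 'I_l -> nat) (t0 : nat) (n0 : 'I_t0 -> nat).
Variables (t1 : nat) (n1 : 'I_t1 -> nat) (r : nat) (q : 'I_r -> nat).

(** One constructor for each kind of summand: a Jordan block of J, then the blocks
    (F, G^T), (I, J(0)), (J'(0), I) and (G^T, F). *)
Definition summand : eqType :=
  ({a : 'I_tau & 'I_(t a)} + (('I_l + 'I_t0) + ('I_t1 + 'I_r)))%type.

Definition nrows (b : summand) : nat :=
  match b with
  | inl s => n (tagged s)
  | inr (inl (inl i)) => p i
  | inr (inl (inr i)) => n0 i
  | inr (inr (inl i)) => n1 i
  | inr (inr (inr i)) => (q i).-1
  end.

Definition ncols (b : summand) : nat :=
  match b with
  | inl s => n (tagged s)
  | inr (inl (inl i)) => (p i).-1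
  | inr (inl (inr i)) => n0 i
  | inr (inr (inl i)) => n1 i
  | inr (inr (inr i)) => q i
  end.

Definition col_first (b : summand) : bool :=
  match b with inr (inr _) => true | _ => false end.

Definition size_summand b := (nrows b + ncols b)%N.

Definition shapeA (b b' : summand) : nat -> nat -> nat -> nat -> bool :=
  match b, b' with
  | inr (inl (inl i)), inr (inl (inl j)) => if (i < j)%N then star else star_none
  | inr (inl (inl _)), inr (inl (inr _)) => star_top
  | inr (inl (inl _)), inr (inr _) => star
  | inr (inl (inr _)), inr (inr (inl _)) => star
  | inr (inl (inr _)), inr (inr (inr _)) => star_right
  | inr (inr (inl _)), inr (inr _) => star
  | inr (inr (inr i)), inr (inr (inr j)) => if (i < j)%N then star else star_none
  | _, _ => star_none
  end.

Definition shapeB (b b' : summand) : nat -> nat -> nat -> nat -> bool :=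
  match b, b' with
  | inl s, inl s' => if tag s == tag s' then star else star_none
  | inr (inl (inl i)), inr (inl (inl j)) => if (j <= i)%N then star else star_none
  | inr (inl (inr _)), inr (inl _) => star
  | inr (inr (inl _)), inr (inl (inl _)) => star_right
  | inr (inr (inl _)), inr (inl (inr _)) => star
  | inr (inr (inr _)), inr (inl _) => star
  | inr (inr (inr _)), inr (inr (inl _)) => star_top
  | inr (inr (inr i)), inr (inr (inr j)) => if (j <= i)%N then star else star_none
  | _, _ => star_none
  end.

Definition starA (x y : summand * nat) :=
  shapeA x.1 y.1 (nrows x.1) (ncols y.1) x.2 y.2.
Definition starB (y x : summand * nat) :=
  shapeB y.1 x.1 (ncols y.1) (nrows x.1) y.2 x.2.

Section Orders.
Local Open Scope nat_scope.
Hypothesis p_noninc : forall i j : 'I_l, (i <= j) -> (p j <= p i).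
Hypothesis q_nondec : forall i j : 'I_r, (i <= j) -> (q i <= q j).

(** Positions along the chains: rows and columns alternate, beginning with the
    side told by [col_first]. *)
Definition row_pos (x : summand * nat) := x.2.*2 + col_first x.1.
Definition col_pos (x : summand * nat) := x.2.*2 + ~~ col_first x.1.

(** The orders of the p_i and of the q_i matter here: they decide whether the
    stars of a block of two summands of the same kind (F, G^T) or (G^T, F) fill
    its first column or its last row, and with the opposite orders some of them
    would leave the diagonals that run from the first column to the last row. *)
Lemma starA_allowed x y : x.2 < nrows x.1 -> y.2 < ncols y.1 -> starA x y ->
  col_pos y <= row_pos x /\
  col_pos y + size_summand x.1 <= row_pos x + size_summand y.1.
Proof.
case: x y => [b k] [b' k']; rewrite /starA /row_pos /col_pos /size_summand /=.
case: b => [s|[[i|i]|[i|i]]]; case: b' => [s'|[[j|j]|[j|j]]] //=;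
  try (case: ifP => // ij);
  rewrite /star_top /star_right /star_none => kr kc;
  try (move=> /andP[kk]); try done;
  rewrite /star; case: ltnP => pq /eqP e;
  try (have := p_noninc (ltnW ij)); try (have := q_nondec (ltnW ij)); lia.
Qed.

Lemma starB_allowed y x : y.2 < ncols y.1 -> x.2 < nrows x.1 -> starB y x ->
  row_pos x <= col_pos y /\
  row_pos x + size_summand y.1 <= col_pos y + size_summand x.1.
Proof.
case: x y => [b k] [b' k']; rewrite /starB /row_pos /col_pos /size_summand /=.
case: b => [s|[[i|i]|[i|i]]]; case: b' => [s'|[[j|j]|[j|j]]] //=;
  try (case: ifP => // ij);
  rewrite /star_top /star_right /star_none => kr kc;
  try (move=> /andP[kk]); try done;
  rewrite /star; case: ltnP => pq /eqP e;
  try (have := p_noninc ij); try (have := q_nondec ij); lia.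
Qed.

Lemma shape_exclusive b b' p1 q1 i1 j1 p2 q2 i2 j2 :
  shapeA b b' p1 q1 i1 j1 -> shapeB b b' p2 q2 i2 j2 -> False.
Proof.
case: b => [s|[[i|i]|[i|i]]]; case: b' => [s'|[[j|j]|[j|j]]] //=.
  by case: ltnP.
by case: ltnP.
Qed.

Definition star_like (S : nat -> nat -> nat -> nat -> bool) :=
  forall p q i j i' j', i < p -> i' < p -> j < q -> j' < q ->
  S p q i j -> S p q i' j' -> i + j' = i' + j -> i = i' /\ j = j'.

Lemma star_like_shape b b' : star_like (shapeA b b') /\ star_like (shapeB b b').
Proof.
have none : star_like star_none by [].
have full : star_like star by move=> *; apply: star_inj; eassumption.
have top : star_like star_top.
  move=> p1 q1 [|i] j [|i'] j' // ip ip' jq jq' s1 s2 e.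
  have [|||||||-> ->] // := @star_inj p1.-1 q1 i j i' j'; lia.
have right : star_like star_right.
  move=> p1 q1 i j i' j' ip ip' jq jq' /andP[h1 s1] /andP[h2 s2] e.
  exact: (star_inj ip ip' h1 h2 s1 s2 e).
by case: b => [s|[[i|i]|[i|i]]]; case: b' => [s'|[[j|j]|[j|j]]] //=;
  split=> //; case: ifP.
Qed.

End Orders.

Section Existence.
Local Open Scope nat_scope.
Hypothesis p_noninc : forall i j : 'I_l, (i <= j) -> (p j <= p i).
Hypothesis q_nondec : forall i j : 'I_r, (i <= j) -> (q i <= q j).

(** Conversely, every diagonal that needs a star has one, in the first or in the
    second matrix.  For Jordan blocks of J the stars are in the second one, and
    its diagonals are those where u is odd. *)
Lemma shape_exists b b' u v :
  (match b, b' with inl s, inl s' => tag s = tag s' /\ odd u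
   | inr _, inr _ => True | _, _ => False end) ->
  odd (u + v) = ~~ (col_first b (+) col_first b') ->
  u < size_summand b -> v < size_summand b' ->
  v <= u -> v + size_summand b <= u + size_summand b' ->
  (exists k k', [/\ k < nrows b, k' < ncols b', shapeA b b' (nrows b) (ncols b') k k' &
     k.*2 + col_first b + v = u + (k'.*2 + ~~ col_first b')]) \/
  (exists k k', [/\ k < ncols b, k' < nrows b', shapeB b b' (ncols b) (nrows b') k k' &
     k.*2 + ~~ col_first b + v = u + (k'.*2 + col_first b')]).
Proof.
rewrite /size_summand.
case: b => [s|[[i|i]|[i|i]]]; case: b' => [s'|[[j|j]|[j|j]]] //=.
- move=> [/eqP-> ou] o h1 h2 h3 h4; right; apply: star_hits; lia.
- move=> _ o h1 h2 h3 h4; case: (ltnP i j) => ij; [left|right]; apply: star_hits; 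
    try (have := p_noninc (ltnW ij)); try (have := p_noninc ij); lia.
- by move=> _ o h1 h2 h3 h4; left; apply: star_top_hits; lia.
- by move=> _ o h1 h2 h3 h4; left; apply: star_hits; lia.
- by move=> _ o h1 h2 h3 h4; left; apply: star_hits; lia.
- by move=> _ o h1 h2 h3 h4; right; apply: star_hits; lia.
- by move=> _ o h1 h2 h3 h4; right; apply: star_hits; lia.
- by move=> _ o h1 h2 h3 h4; left; apply: star_hits; lia.
- by move=> _ o h1 h2 h3 h4; left; apply: star_right_hits; lia.
- by move=> _ o h1 h2 h3 h4; right; apply: star_right_hits; lia.
- by move=> _ o h1 h2 h3 h4; right; apply: star_hits; lia.
- by move=> _ o h1 h2 h3 h4; left; apply: star_hits; lia.
- by move=> _ o h1 h2 h3 h4; left; apply: star_hits; lia.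
- by move=> _ o h1 h2 h3 h4; right; apply: star_hits; lia.
- by move=> _ o h1 h2 h3 h4; right; apply: star_hits; lia.
- by move=> _ o h1 h2 h3 h4; right; apply: star_top_hits; lia.
- move=> _ o h1 h2 h3 h4; case: (ltnP i j) => ij; [left|right]; apply: star_hits;
    try (have := q_nondec (ltnW ij)); try (have := q_nondec ij); lia.
Qed.
End Existence.
End Canonical.

(** * Entries of the canonical pair and of its stars *)

Section Entries.
Variables (K : numFieldType).
Variables (tau : nat) (lambda : 'I_tau -> K).
Variables (t : 'I_tau -> nat) (n : forall a : 'I_tau, 'I_(t a) -> nat).
Variables (l : nat) (p : 'I_l -> nat) (t0 : nat) (n0 : 'I_t0 -> nat).
Variables (t1 : nat) (n1 : 'I_t1 -> nat) (r : nat) (q : 'I_r -> nat).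

Local Notation summand := (summand t l t0 t1 r).
Local Notation nrows := (@nrows tau t n l p t0 n0 t1 n1 r q).
Local Notation ncols := (@ncols tau t n l p t0 n0 t1 n1 r q).

Definition row_coord := sum_coord (@nested_coord _ _ n)
  (sum_coord (sum_coord (@block_coord _ p) (@block_coord _ n0))
     (sum_coord (@block_coord _ n1) (@block_coord _ (fun i => (q i).-1)))).

Definition col_coord := sum_coord (@nested_coord _ _ n)
  (sum_coord (sum_coord (@block_coord _ (fun i => (p i).-1)) (@block_coord _ n0))
     (sum_coord (@block_coord _ n1) (@block_coord _ q))).

Lemma eq_coordinates A (d d' : A -> nat) N (f : 'I_N -> A * nat) :
  d =1 d' -> coordinates d f -> coordinates d' f.
Proof.
move=> dd [f1 f2 f3]; split=> [i||a k]; first by rewrite -dd.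
  exact: f2.
by rewrite -dd; exact: f3.
Qed.

Lemma row_coordinates : coordinates nrows (row_coord : _ -> summand * nat).
Proof.
have := sum_coordinates (nested_coordinates n) (sum_coordinates
  (sum_coordinates (block_coordinates p) (block_coordinates n0))
  (sum_coordinates (block_coordinates n1) (block_coordinates (fun i => (q i).-1)))).
by apply: eq_coordinates => -[?|[[?|?]|[?|?]]].
Qed.

Lemma col_coordinates : coordinates ncols (col_coord : _ -> summand * nat).
Proof.
have := sum_coordinates (nested_coordinates n) (sum_coordinates
  (sum_coordinates (block_coordinates (fun i => (p i).-1)) (block_coordinates n0))
  (sum_coordinates (block_coordinates n1) (block_coordinates q))).
by apply: eq_coordinates => -[?|[[?|?]|[?|?]]].
Qed.

Definition eigenvalue_of (b : summand) : K :=
  match b with inl s => lambda (tag s) | inr _ => 0 end.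

Definition entryC (x y : summand * nat) : K :=
  ((x.1 == y.1) && (col_pos y == (row_pos x).+1))%:R.

Definition entryD (y x : summand * nat) : K :=
  ((y.1 == x.1) && (row_pos x == (col_pos y).+1))%:R +
  ((x.1 == y.1) && (col_pos y == (row_pos x).+1))%:R * eigenvalue_of x.1.

Let inl_eq (A B : eqType) (a a' : A) : (inl a == inl a' :> A + B) = (a == a').
Proof. by []. Qed.

Let inr_eq (A B : eqType) (b b' : B) : (inr b == inr b' :> A + B) = (b == b').
Proof. by []. Qed.

Let double_eq a b : (b.*2 + 1 == (a.*2 + 0).+1)%N = (b == a).
Proof. by rewrite addn0 addn1 eqSS; apply/eqP/eqP => [/double_inj|->]. Qed.

Let double_eqS a b : (b.*2 + 0 == (a.*2 + 1).+1)%N = (b == a.+1).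
Proof.
rewrite addn0 addn1 -doubleS; by apply/eqP/eqP => [/double_inj|->].
Qed.

Let posE := (inl_eq, inr_eq, eqxx, double_eq, double_eqS).

Let entryC0 x y : x.1 != y.1 -> entryC x y = 0.
Proof. by rewrite /entryC => /negPf ->. Qed.

Let entryD0 x y : x.1 != y.1 -> entryD y x = 0.
Proof.
by move=> /negPf xy; rewrite /entryD xy eq_sym xy mul0r addr0.
Qed.

Lemma canonical_C :
  described (block_mx 1%:M 0 0 (canA K p n0 n1 q)) row_coord col_coord entryC.
Proof.
apply: described_block; [|by apply: described_0|by apply: described_0|].
  apply: (described_1 (nested_coordinates n)) => -[s k] [s' k'].
  by rewrite /entryC /row_pos /col_pos /= !posE xpair_eqE [k' == k]eq_sym.
apply: described_block; apply: described_block;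
  try by apply: described_0 => i j; exact: entryC0.
- apply: described_dsum => [i x y|i j k k' ij]; last by apply: entryC0.
  by rewrite mxE /entryC /row_pos /col_pos /= !posE eq_sym.
- apply: (described_1 (block_coordinates n0)) => -[s k] [s' k'].
  by rewrite /entryC /row_pos /col_pos /= !posE xpair_eqE [k' == k]eq_sym.
- apply: described_dsum => [i x y|i j k k' ij]; last by apply: entryC0.
  by rewrite mxE /entryC /row_pos /col_pos /= !posE mul0rn add0r.
- apply: described_dsum => [i x y|i j k k' ij]; last by apply: entryC0.
  by rewrite !mxE /entryC /row_pos /col_pos /= !posE.
Qed.

Lemma canonical_D :
  described (block_mx (Jfull n lambda) 0 0 (canB K p n0 n1 q)) col_coord row_coord entryD.
Proof.
apply: described_block; [|by apply: described_0 => i j; exact: entryD0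
  |by apply: described_0 => i j; exact: entryD0|].
  apply: described_nested => [a|[s k] [s' k'] ab]; last first.
    apply: entryD0; rewrite /= inl_eq; apply: contraNneq ab => -> //.
  apply: described_dsum => [i x y|i j k k' ij]; last first.
    by apply: entryD0; rewrite /= inl_eq eq_Tagged eq_sym.
  rewrite mxE /entryD /row_pos /col_pos /= !posE addrC.
  by rewrite mulr_natl.
apply: described_block; apply: described_block;
  try by apply: described_0 => i j; exact: entryD0.
- apply: described_dsum => [i x y|i j k k' ij];
    last by apply: entryD0; rewrite /= eq_sym.
  by rewrite !mxE /entryD /row_pos /col_pos /= !posE mulr0 addr0.
- apply: described_dsum => [i x y|i j k k' ij];
    last by apply: entryD0; rewrite /= eq_sym.
  by rewrite !mxE /entryD /row_pos /col_pos /= !posE mulr0 addr0 mul0rn add0r.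
- apply: (described_1 (block_coordinates n1)) => -[s k] [s' k'].
  by rewrite /entryD /row_pos /col_pos /= !posE xpair_eqE mulr0 addr0 [k' == k]eq_sym.
- apply: described_dsum => [i x y|i j k k' ij];
    last by apply: entryD0; rewrite /= eq_sym.
  by rewrite !mxE /entryD /row_pos /col_pos /= !posE mulr0 addr0 eq_sym.
Qed.

Local Notation starA := (@starA tau t n l p t0 n0 t1 n1 r q).
Local Notation starB := (@starB tau t n l p t0 n0 t1 n1 r q).

Lemma stars_A :
  described (block_mx (0 : 'M[bool]_(\sum_a \sum_i @n a i)) 0 0 (starsA p n0 n1 q))
    row_coord col_coord starA.
Proof.
apply: described_block; try by apply: described_0.
  apply: described_0 => i j; rewrite /starA /=.
  by case: (sum_coord _ _ _).1 => [[?|?]|[?|?]].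
apply: described_block; apply: described_block; try by apply: described_0.
- apply: described_mxblock => i j x y; rewrite /starA /=.
  by case: ifP; rewrite mxE.
- by apply: described_mxblock => i j x y; rewrite mxE.
- by apply: described_mxblock => i j x y; rewrite mxE.
- by apply: described_mxblock => i j x y; rewrite mxE.
- by apply: described_mxblock => i j x y; rewrite mxE.
- by apply: described_mxblock => i j x y; rewrite mxE.
- by apply: described_mxblock => i j x y; rewrite mxE.
- by apply: described_mxblock => i j x y; rewrite mxE.
- apply: described_mxblock => i j x y; rewrite /starA /=.
  by case: ifP; rewrite mxE.
Qed.

Lemma stars_B :
  described (block_mx (starsK n) 0 0 (starsB p n0 n1 q)) col_coord row_coord starB.
Proof.
apply: described_block; try by apply: described_0.
- apply: described_nested => [a|[s k] [s' k'] /= ab]; last first.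
    by rewrite /starB /= (negPf ab).
  by apply: described_mxblock => i j x y; rewrite mxE /starB /= eqxx.
- apply: described_0 => i j; rewrite /starB /=.
  by case: (sum_coord _ _ _).1 => [[?|?]|[?|?]].
apply: described_block; apply: described_block; try by apply: described_0.
- apply: described_mxblock => i j x y; rewrite /starB /=.
  by case: ifP; rewrite mxE.
- by apply: described_mxblock => i j x y; rewrite mxE.
- by apply: described_mxblock => i j x y; rewrite mxE.
- by apply: described_mxblock => i j x y; rewrite mxE.
- by apply: described_mxblock => i j x y; rewrite mxE.
- by apply: described_mxblock => i j x y; rewrite mxE.
- by apply: described_mxblock => i j x y; rewrite mxE.
- by apply: described_mxblock => i j x y; rewrite mxE.
- apply: described_mxblock => i j x y; rewrite /starB /=.
  by case: ifP; rewrite mxE.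
Qed.

End Entries.

(** * Norms and differentiability over the complex numbers *)

Section RealNorm.
Local Open Scope classical_set_scope.
Local Open Scope complex_scope.
Variable R : realType.
Local Notation K := R[i].

(** The norm over R[i] takes its values in R[i]; as a real number it is subject to
    real arithmetic. *)
Definition rnorm (V : normedModType K) (v : V) : R := complex.Re `|v|.

Variable V : normedModType K.
Implicit Types v w : V.

Lemma rnormE v : `|v| = (rnorm v)%:C.
Proof. by rewrite /rnorm RRe_real ?normr_real. Qed.

Lemma rnorm_ge0 v : 0 <= rnorm v.
Proof. by rewrite -ler0c -rnormE. Qed.

Lemma rnorm0 : rnorm (0 : V) = 0.
Proof. by rewrite /rnorm normr0. Qed.

Lemma rnorm0_eq0 v : rnorm v = 0 -> v = 0.
Proof. by move=> v0; apply/normr0_eq0; rewrite rnormE v0. Qed.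

Lemma ler_rnormD v w : rnorm (v + w) <= rnorm v + rnorm w.
Proof. by rewrite -lecR rmorphD /= -!rnormE ler_normD. Qed.

Lemma rnormN v : rnorm (- v) = rnorm v.
Proof. by rewrite /rnorm normrN. Qed.

Lemma rnorm_near (P : V -> Prop) (e : R) : 0 < e ->
  (forall v, rnorm v < e -> P v) -> \forall v \near (0 : V), P v.
Proof.
move=> e0 eP; apply/nbhs_ballP; exists e%:C; first by rewrite /= ltcR.
move=> v; rewrite -ball_normE /= sub0r normrN => ve; apply: eP.
by rewrite -ltcR -rnormE.
Qed.

Lemma near_rnorm (P : V -> Prop) : (\forall v \near (0 : V), P v) ->
  exists2 e : R, 0 < e & forall v, rnorm v < e -> P v.
Proof.
move=> /nbhs_ballP[e /= e0 eP]; exists (complex.Re e).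
  by rewrite -ltcR RRe_real // gtr0_real.
move=> v ve; apply: eP; rewrite -ball_normE /= sub0r normrN rnormE.
by rewrite -(RRe_real (gtr0_real e0)) ltcR.
Qed.
End RealNorm.

Section Diff.
Local Open Scope classical_set_scope.
Local Open Scope complex_scope.
Variable R : realType.
Local Notation K := R[i].
Variables V W : normedModType K.

Lemma rnorm_bounded_continuous (A : {linear V -> W}) (k : R) :
  (forall v, rnorm (A v) <= k * rnorm v) -> continuous A.
Proof.
move=> Ak; apply/linear_bounded_continuous/linear_boundedP.
exists `|k|%:C; split; first by rewrite complex_real.
move=> x kx v.
have -> : x = (complex.Re x)%:C.
  by rewrite RRe_real // gtr0_real // (le_lt_trans _ kx) // ler0c.
rewrite !rnormE -rmorphM /= lecR.
apply: (le_trans (Ak v)); rewrite ler_wpM2r ?rnorm_ge0 //.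
apply: (le_trans (ler_norm k)).
by move: kx; rewrite ltcE /= => /andP[_ /ltW].
Qed.

(** Linear maps, matrix products and solutions of quadratic equations all have
    remainders bounded by a square, uniformly in a neighborhood. *)
Lemma quadratic_remainder_diff (f : V -> W) (x : V) (A : {linear V -> W})
    (k k' e : R) :
  0 < e -> (forall v, rnorm (A v) <= k' * rnorm v) ->
  (forall v, rnorm v < e -> rnorm (f (v + x) - f x - A v) <= k * rnorm v ^+ 2) ->
  is_diff x f A.
Proof.
move=> e0 Ak fk.
have Ac := rnorm_bounded_continuous Ak.
pose h v := f (v + x) - f x - A v.
have ho : h =o_ (0 : V) id.
  apply/eqoP => d d0; pose d1 := complex.Re d.
  have dE : d = d1%:C by rewrite RRe_real // gtr0_real.
  have d10 : 0 < d1 by rewrite -ltcR -dE.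
  apply: (@rnorm_near _ _ _ (Num.min e (d1 / (`|k| + 1)))) => [|v].
    by rewrite lt_min e0 divr_gt0 // ltr_wpDl.
  rewrite lt_min => /andP[ve vd]; rewrite !rnormE dE -rmorphM lecR.
  apply: (le_trans (fk _ ve)); rewrite expr2 mulrA ler_wpM2r ?rnorm_ge0 //.
  move: vd; rewrite ltr_pdivlMr ?ltr_wpDl // => /ltW; apply: le_trans.
  rewrite mulrC ler_wpM2l ?rnorm_ge0 //.
  by rewrite (le_trans (ler_norm k)) // lerDl.
have fE : f \o shift x = cst (f x) + A +o_ 0 id.
  have -> : f \o shift x = cst (f x) + A + h.
    rewrite funeqE => v /=; rewrite /h.
    change (f (v + x) = f x + A v + (f (v + x) - f x - A v)).
    by rewrite -[_ - A v]addrA -opprD subrKC.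
  by rewrite ho.
apply: DiffDef; last exact: diff_unique.
by apply/diff_locallyP; rewrite (diff_unique Ac fE).
Qed.
End Diff.

Section MatrixNorm.
Local Open Scope classical_set_scope.
Local Open Scope complex_scope.
Variable R : realType.
Local Notation K := R[i].
Local Notation modulus a := (@rnorm R K^o a).

Lemma rnormZ (V : normedModType K) (a : K) (v : V) :
  rnorm (a *: v) = modulus a * rnorm v.
Proof. by apply/complexI; rewrite rmorphM /= -!rnormE normrZ. Qed.

Lemma modulusM (a b : K) : modulus (a * b) = modulus a * modulus b.
Proof. exact: (@rnormZ K^o). Qed.

Lemma ler_rnorm_sum (V : normedModType K) (I : Type) (r : seq I) (P : pred I)
    (F : I -> V) :
  rnorm (\sum_(i <- r | P i) F i) <= \sum_(i <- r | P i) rnorm (F i).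
Proof.
elim/big_rec2 : _ => [|i y1 y2 _ le]; first by rewrite rnorm0.
by rewrite (le_trans (ler_rnormD _ _)) // lerD2l.
Qed.

Lemma rnorm_pair (V W : normedModType K) (v : V) (w : W) :
  rnorm (v, w) = Num.max (rnorm v) (rnorm w).
Proof.
apply/complexI; rewrite -rnormE prod_normE /= !rnormE.
by rewrite !maxEle lecR; case: ifP.
Qed.

Section Fixed.
Variables m n : nat.
Implicit Types M : 'M[K]_(m, n).

Lemma rnorm_entry M i j : modulus (M i j) <= rnorm M.
Proof.
rewrite -lecR -!rnormE {2}/Num.norm /= mx_normE.
rewrite -[leLHS]nngE num_le.
exact: (le_bigmax _ (fun i => `|M i.1 i.2|%:nng) (i, j)).
Qed.

Lemma rnorm_mx_le M r : 0 <= r -> (forall i j, modulus (M i j) <= r) ->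
  rnorm M <= r.
Proof.
move=> r0 Mr; have r0' : 0 <= r%:C by rewrite ler0c.
rewrite -lecR -rnormE {1}/Num.norm /= mx_normE.
have -> : r%:C = (NngNum r0')%:num by [].
rewrite num_le; apply/bigmax_leP; split=> // -[i j] _ /=.
by rewrite -num_le /= rnormE lecR.
Qed.

Lemma linear_mx_bounded (W : normedModType K) (f : {linear 'M[K]_(m, n) -> W}) :
  exists2 k, 0 <= k & forall M, rnorm (f M) <= k * rnorm M.
Proof.
exists (\sum_i \sum_j rnorm (f (delta_mx i j))).
  by apply: sumr_ge0 => i _; apply: sumr_ge0 => j _; exact: rnorm_ge0.
move=> M; rewrite {1}[M]matrix_sum_delta linear_sum mulr_suml.
apply: (le_trans (ler_rnorm_sum _ _ _)); apply: ler_sum => i _.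
rewrite linear_sum mulr_suml.
apply: (le_trans (ler_rnorm_sum _ _ _)); apply: ler_sum => j _.
by rewrite linearZ /= rnormZ mulrC ler_wpM2l ?rnorm_ge0 ?rnorm_entry.
Qed.

End Fixed.

Lemma rnorm_mulmx m n p (A : 'M[K]_(m, n)) (B : 'M[K]_(n, p)) :
  rnorm (A *m B) <= n%:R * (rnorm A * rnorm B).
Proof.
apply: rnorm_mx_le => [|i j]; first by rewrite !mulr_ge0 ?rnorm_ge0.
rewrite mxE; apply: (le_trans (ler_rnorm_sum _ _ _)).
rewrite mulr_natl.
have -> : rnorm A * rnorm B *+ n = \sum_(k < n) rnorm A * rnorm B.
  by rewrite sumr_const card_ord.
apply: ler_sum => k _.
by rewrite modulusM ler_pM ?rnorm_ge0 ?rnorm_entry.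
Qed.

End MatrixNorm.

(* Real matrices form a Banach space. *)
HB.instance Definition _ (R : realType) (m n : nat) :=
  Complete.on 'M[R]_(m, n).

Section Picard.
Local Open Scope classical_set_scope.
Local Open Scope complex_scope.
Variables (R : realType) (N : nat).
Local Notation K := R[i].
Local Notation modulus a := (@rnorm R K^o a).

(* Complex vectors are viewed as pairs of real ones, to apply the fixed point
   theorem over the complete field R. *)
Let toC (x : 'M[R]_(2, N)) : 'rV[K]_N := \row_j (x 0 j +i* x 1 j).
Let ofC (v : 'rV[K]_N) : 'M[R]_(2, N) :=
  \matrix_(i, j) (if i == 0 then complex.Re (v 0 j) else complex.Im (v 0 j)).

Let toCK v : toC (ofC v) = v.
Proof. by apply/rowP => j; rewrite !mxE /=; case: (v 0 j). Qed.

Let toCB x y : toC (x - y) = toC x - toC y.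
Proof. by apply/rowP => j; rewrite !mxE. Qed.

Let ofCB x y : ofC (x - y) = ofC x - ofC y.
Proof.
by apply/matrixP => i j; rewrite !mxE; case: ifP => _; case: (x 0 j) (y 0 j) => ? ? [].
Qed.

Lemma ler_entry_norm m n (M : 'M[R]_(m, n)) i j : `|M i j| <= `|M|.
Proof.
rewrite {2}/Num.norm /= mx_normrE.
exact: (le_bigmax _ (fun i => `|M i.1 i.2|) (i, j)).
Qed.

Let norm_toC x : rnorm (toC x) <= 2 * `|x|.
Proof.
apply: rnorm_mx_le => [|i j]; first by rewrite mulr_ge0.
rewrite mxE [_ +i* _]complexE /= mulr2n mulrDl mul1r.
apply: (le_trans (ler_rnormD _ _)).
have rE (a : R) : modulus a%:C = `|a|.
  by apply/complexI; rewrite -rnormE normc_def /= expr0n addr0 sqrtr_sqr.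
rewrite modulusM !rE.
have -> : modulus 'i%C = 1.
  by apply/complexI; rewrite -rnormE normc_def /= expr0n add0r expr1n sqrtr1.
by rewrite mul1r lerD // ler_entry_norm.
Qed.

Let norm_ofC v : `|ofC v| <= rnorm v.
Proof.
rewrite {1}/Num.norm /= mx_normrE; apply/bigmax_leP; split=> [|[i j] _ /=].
  exact: rnorm_ge0.
rewrite mxE; apply: (le_trans _ (rnorm_entry v 0 j)).
rewrite -lecR -rnormE; case: ifP => _; first exact: normc_ge_Re.
rewrite normc_def lecR -sqrtr_sqr ler_wsqrtr // lerDr sqr_ge0 //.
Qed.

(** The real norm of a vector and its complex one agree up to a factor 2 only;
    hence the ratios 1 / 2 and 1 / 4, smaller than a contraction over R[i] itself
    would need. *)
Lemma contraction_fixpoint (f : 'rV[K]_N -> 'rV[K]_N) (r : R) : 0 <= r ->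
  (forall x, rnorm x <= r -> rnorm (f x) <= r / 2) ->
  (forall x y, rnorm x <= r -> rnorm y <= r ->
     rnorm (f x - f y) <= rnorm (x - y) / 4) ->
  exists2 x, rnorm x <= r & f x = x.
Proof.
move=> r0 fr flip.
pose U := [set x : 'M[R]_(2, N) | `|x| <= r / 2].
have Ur x : U x -> rnorm (toC x) <= r.
  rewrite /U /= => xr; apply: (le_trans (norm_toC x)); lra.
pose g := ofC \o f \o toC.
have gU : {homo g : x / U x >-> U x}.
  move=> x Ux; rewrite /U /g /=; apply: (le_trans (norm_ofC _)).
  by apply: fr; exact: Ur.
have gfun : isFun _ _ U U g by split.
pose G : {fun U >-> U} := HB.pack g gfun.
have Gc : is_contraction G.
  exists (2^-1)%:nng; split=> /=; first by rewrite invf_lt1 // ltr1n.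
  move=> [x y] /= [Ux Uy]; rewrite /g /= -ofCB.
  apply: (le_trans (norm_ofC _)); apply: (le_trans (flip _ _ (Ur _ Ux) (Ur _ Uy))).
  rewrite -toCB; have := norm_toC (x - y); lra.
have Ucl : closed U.
  have -> : U = Num.norm @^-1` [set y : R | y <= r / 2] by [].
  by apply: closed_comp => [x _|]; [exact: norm_continuous|exact: closed_le].
have [] := @banach_fixed_point R 'M[R]_(2, N) U G Gc Ucl.
  by exists 0; rewrite /U /= normr0 divr_ge0.
move=> x Ux xE; exists (toC x); first exact: Ur.
by rewrite {2}xE /G /= /g /= toCK.
Qed.
End Picard.

(** * A holomorphic implicit function theorem *)

Section QuadraticImplicit.
Local Open Scope classical_set_scope.
Local Open Scope complex_scope.
Variables (R : realType) (N : nat).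
Local Notation K := R[i].
Local Notation V := 'rV[K]_N.
Variable G : {bilinear V * V -> V -> V}.
Variable b : R.
Hypothesis b_ge0 : 0 <= b.
Hypothesis Gb : forall p v, rnorm (G p v) <= b * (rnorm p * rnorm v).

(* When one argument of G lies in the ball of radius r, the norm of its value is
   at most 1 / 16 of that of the other argument. *)
Let r := (16 * (b + 1))^-1.
Let r_gt0 : 0 < r. Proof. by rewrite invr_gt0 mulr_gt0 // ltr_wpDl. Qed.
Let br : b * r <= 1 / 16.
Proof.
rewrite /r invfM mulrCA mul1r ler_piMr ?invr_ge0 //.
by rewrite ler_pdivrMr ?ltr_wpDl // mul1r lerDl.
Qed.

Let Gr p v : rnorm p <= r -> rnorm (G p v) <= rnorm v / 16.
Proof.
move=> pr; apply: (le_trans (Gb p v)); rewrite mulrA mulrC.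
rewrite ler_wpM2l ?rnorm_ge0 // -[16^-1]mul1r.
by apply: le_trans br; rewrite ler_wpM2l.
Qed.

Let Gr' p v : rnorm v <= r -> rnorm (G p v) <= rnorm p / 16.
Proof.
move=> vr; apply: (le_trans (Gb p v)); rewrite mulrCA.
rewrite ler_wpM2l ?rnorm_ge0 // -[16^-1]mul1r.
by apply: le_trans br; rewrite ler_wpM2l.
Qed.

Let rnorm_pair_le (E F : V) c :
  rnorm E <= c -> rnorm F <= c -> rnorm (E, F) <= c.
Proof. by rewrite rnorm_pair ge_max => -> ->. Qed.

Let rnorm_0pair (F : V) : rnorm (0 : V, F) = rnorm F.
Proof. by rewrite rnorm_pair rnorm0 max_r ?rnorm_ge0. Qed.

Let rnorm_pair_add (E F : V) : rnorm (E, F) <= rnorm E + rnorm F.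
Proof. by apply: rnorm_pair_le; rewrite ?lerDl ?lerDr rnorm_ge0. Qed.

Let GB E F F' : G (E, F) F - G (E, F') F' = G (E, F) (F - F') + G (0, F - F') F'.
Proof.
have -> : (0, F - F') = (E, F) - (E, F') by congr pair; rewrite subrr.
by rewrite linearBl linearBr /= addrA subrK.
Qed.

(* The increments of E and F satisfy a linear equation up to a term that is
   quadratic in them: this is where the derivative of F comes from. *)
Let incr E F E' F' : F = E + G (E, F) F -> F' = E' + G (E', F') F' ->
  (F' - F) - G (E, F) (F' - F) - G (0, F' - F) F =
  (E' - E) + G (E' - E, 0) F + G (E' - E, F' - F) (F' - F).
Proof.
move=> FE FE'; apply/eqP; rewrite subr_eq subr_eq; apply/eqP.
rewrite {1}FE' {1}FE.
have -> : G (E', F') F' = G (E, F) F' + G (E' - E, F' - F) F'.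
  have -> : (E' - E, F' - F) = (E', F') - (E, F) by [].
  by rewrite linearBl subrKC.
have -> : G (E' - E, F' - F) F' =
    G (E' - E, 0) F + G (0, F' - F) F + G (E' - E, F' - F) (F' - F).
  have -> : (E' - E, F' - F) = (E' - E, 0) + (0, F' - F).
    by congr pair; rewrite ?addr0 ?add0r.
  by rewrite !linearDl /= !linearBr /= addrACA !subrKC.
rewrite [G (E, F) (F' - F)]linearBr /= opprD !addrA.
by rewrite [LHS](ACl (1*6*3*5*4*2*7)).
Qed.

Let ball_fixpoint E : rnorm E <= r / 4 ->
  exists2 F, rnorm F <= r & E + G (E, F) F = F.
Proof.
move=> Er; have r0 := ltW r_gt0.
have Er' : rnorm E <= r by apply: (le_trans Er); lra.
apply: contraction_fixpoint => // [F Fr|F F' Fr Fr'].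
  have := Gr F (rnorm_pair_le Er' Fr).
  have := ler_rnormD E (G (E, F) F); lra.
have -> : E + G (E, F) F - (E + G (E, F') F') = G (E, F) F - G (E, F') F'.
  by rewrite opprD addrACA subrr add0r.
rewrite GB.
have := ler_rnormD (G (E, F) (F - F')) (G (0, F - F') F').
have := Gr (F - F') (rnorm_pair_le Er' Fr).
have := Gr' (0, F - F') Fr'; rewrite rnorm_0pair.
have := rnorm_ge0 (F - F'); lra.
Qed.

Let fixpoint_lipschitz E F E' F' :
  rnorm E <= r / 4 -> rnorm E' <= r / 4 -> rnorm F <= r -> rnorm F' <= r ->
  F = E + G (E, F) F -> F' = E' + G (E', F') F' ->
  rnorm (F' - F) <= 2 * rnorm (E' - E).
Proof.
move=> Er Er' Fr Fr' FE FE'; have r0 := ltW r_gt0.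
have Er1 : rnorm E <= r by lra.
have Er1' : rnorm E' <= r by lra.
have e : G (E', F') (F' - F) + G (E' - E, F' - F) F =
    G (E', F') F' - G (E, F) F.
  have -> : (E' - E, F' - F) = (E', F') - (E, F) by [].
  by rewrite linearBl linearBr /= addrA subrK.
have {}e : F' - F = (E' - E) + (G (E', F') (F' - F) + G (E' - E, F' - F) F).
  by rewrite e {1}FE' {1}FE opprD addrACA.
have := ler_rnormD (E' - E) (G (E', F') (F' - F) + G (E' - E, F' - F) F).
rewrite -e.
have := ler_rnormD (G (E', F') (F' - F)) (G (E' - E, F' - F) F).
have := Gr (F' - F) (rnorm_pair_le Er1' Fr').
have := Gr' (E' - E, F' - F) Fr.
have := rnorm_pair_add (E' - E) (F' - F).
have := rnorm_ge0 (F' - F); have := rnorm_ge0 (E' - E).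
lra.
Qed.

Section Inverse.
Variables E F : V.
Hypotheses (Er : rnorm E <= r) (Fr : rnorm F <= r).

Let L v := v - G (E, F) v - G (0, v) F.

Let L_linear : linear L.
Proof.
move=> a u v; rewrite /L.
have -> : (0, a *: u + v) = a *: (0, u) + (0, v) :> V * V.
  by congr pair; rewrite /= scaler0 addr0.
rewrite linearPr linearPl /= !opprD !scalerDr !scalerN.
by rewrite !addrA [LHS](ACl (1*3*5*2*4*6)).
Qed.

Let L_lower v : rnorm v <= 2 * rnorm (L v).
Proof.
have e : v = L v + (G (E, F) v + G (0, v) F).
  by rewrite /L -[_ - G (0, v) F]addrA -opprD subrK.
have := ler_rnormD (L v) (G (E, F) v + G (0, v) F); rewrite -e.
have := ler_rnormD (G (E, F) v) (G (0, v) F).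
have := Gr v (rnorm_pair_le Er Fr).
have := Gr' (0, v) Fr; rewrite rnorm_0pair.
have := rnorm_ge0 v; lra.
Qed.

(** The linear part of the equation for the increments, F' |-> F' - G ((E, F), F')
    - G ((0, F'), F), is a small perturbation of the identity: it is injective
    with a bounded inverse, and finite dimension does the rest. *)
Lemma linearized_inverse : exists T : {linear V -> V},
  (forall v, T (L v) = v) /\ (forall y, rnorm (T y) <= 2 * rnorm y).
Proof.
pose LL : {linear V -> V} := HB.pack L (GRing.isLinear.Build _ _ _ _ _ L_linear).
pose M := lin1_mx LL.
have ME v : v *m M = L v by rewrite mul_rV_lin1.
have Mu : M \in unitmx.
  rewrite -row_free_unit -kermx_eq0; apply/eqP/row_matrixP => i.
  rewrite row0; apply: rnorm0_eq0.
  have k0 : row i (kermx M) *m M = 0 by rewrite -row_mul mulmx_ker row0.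
  have := L_lower (row i (kermx M)); rewrite -ME k0 rnorm0 mulr0.
  by move=> h; apply/le_anti; rewrite h rnorm_ge0.
exists (mulmxr (invmx M)); split=> [v|y] /=.
  by rewrite -ME mulmxK.
by have := L_lower (y *m invmx M); rewrite -ME mulmxKV.
Qed.

End Inverse.

(** The derivative at E is T (e + G ((e, 0), F)) with T the inverse above; the
    remainder is T applied to the quadratic term, bounded because F is
    2-Lipschitz. *)
Lemma quadratic_implicit : exists f : V -> V,
  [/\ f 0 = 0, holomorphic_at0 f &
      \forall E \near (0 : (V : normedModType K)), f E = E + G (E, f E) (f E)].
Proof.
have /choice[f fP] : forall E, exists F, rnorm E <= r / 4 ->
    rnorm F <= r /\ F = E + G (E, F) F.
  move=> E; have [Er|Er] := leP (rnorm E) (r / 4); last first.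
    by exists 0.
  by have [F Fr FE] := ball_fixpoint Er; exists F.
have r0 := r_gt0; have r40 : 0 < r / 4 by rewrite divr_gt0.
have f0 : f 0 = 0.
  have [|fr fE] := fP 0; first by rewrite rnorm0 ltW.
  apply: rnorm0_eq0.
  have := @fixpoint_lipschitz 0 0 0 (f 0); rewrite !rnorm0 subrr rnorm0 subr0.
  move=> /(_ (ltW r40) (ltW r40) (ltW r0) fr); rewrite linear0r addr0 mulr0.
  by move=> /(_ erefl fE) h; apply/le_anti; rewrite h rnorm_ge0.
exists f; split=> //; last first.
  by apply: (rnorm_near r40) => E /ltW Er; have [] := fP _ Er.
have r80 : 0 < r / 8 by rewrite divr_gt0.
apply: (rnorm_near r80) => E Er.
have {}Er4 : rnorm E <= r / 4 by lra.
have [Fr FE] := fP _ Er4.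
have Er1 : rnorm E <= r by lra.
have [T [TK Tle]] := linearized_inverse Er1 Fr.
pose A e := T (e + G (e, 0) (f E)).
have A_linear : linear A.
  move=> a u v; rewrite /A -linearP; congr (T _).
  have -> : (a *: u + v, 0) = a *: (u, 0) + (v, 0) :> V * V.
    by congr pair; rewrite /= scaler0 addr0.
  by rewrite linearPl /= scalerDr addrACA.
pose AA : {linear V -> V} := HB.pack A (GRing.isLinear.Build _ _ _ _ _ A_linear).
suff : is_diff E f AA by [].
apply: (@quadratic_remainder_diff _ _ _ f E AA (12 * b) 4 (r / 8) r80) => v /=.
  rewrite /A; apply: (le_trans (Tle _)).
  have := ler_rnormD v (G (v, 0) (f E)).
  have := Gr' (v, 0) Fr.
  have := rnorm_pair_add v 0; rewrite rnorm0.
  have := rnorm_ge0 v; lra.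
move=> vr; have vEr : rnorm (v + E) <= r / 4.
  have := ler_rnormD v E; lra.
have [Fr' FE'] := fP _ vEr.
have := incr FE FE'; rewrite addrK => inc.
have -> : f (v + E) - f E - A v = T (G (v, f (v + E) - f E) (f (v + E) - f E)).
  by rewrite -{1}(TK (f (v + E) - f E)) inc /A -linearB addrAC subrr add0r.
apply: (le_trans (Tle _)).
have := fixpoint_lipschitz Er4 vEr Fr Fr' FE FE'; rewrite addrK => lip.
have pl : rnorm (v, f (v + E) - f E) <= 3 * rnorm v.
  have := rnorm_pair_add v (f (v + E) - f E); lra.
have -> : 12 * b * rnorm v ^+ 2 = 2 * (b * ((3 * rnorm v) * (2 * rnorm v))).
  by ring.
rewrite ler_wpM2l //; apply: (le_trans (Gb _ _)); rewrite ler_wpM2l //.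
by rewrite ler_pM ?rnorm_ge0.
Qed.

End QuadraticImplicit.

(** * Differential calculus of matrix functions *)

Section Calculus.
Local Open Scope classical_set_scope.
Local Open Scope complex_scope.
Variable R : realType.
Local Notation K := R[i].

Lemma bounded_linear_diff (V W : normedModType K) (A : {linear V -> W}) (c : R)
    (x : V) :
  (forall v, rnorm (A v) <= c * rnorm v) -> is_diff x A A.
Proof.
move=> Ac; apply: (quadratic_remainder_diff (k := 0) ltr01 Ac) => v _.
by rewrite linearD addrK subrr rnorm0 mul0r.
Qed.

Lemma is_diff_fst (V W : normedModType K) (p : V * W) : is_diff p fst fst.
Proof.
apply: (@bounded_linear_diff (V * W)%type V fst 1) => -[v w] /=.
by rewrite mul1r rnorm_pair le_max lexx.
Qed.

Lemma is_diff_snd (V W : normedModType K) (p : V * W) : is_diff p snd snd.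
Proof.
apply: (@bounded_linear_diff (V * W)%type W snd 1) => -[v w] /=.
by rewrite mul1r rnorm_pair le_max lexx orbT.
Qed.

Lemma is_diff_mx_linear m n (W : normedModType K)
    (A : {linear 'M[K]_(m, n) -> W}) x : is_diff x A A.
Proof. by have [c _ Ac] := linear_mx_bounded A; apply: bounded_linear_diff Ac. Qed.

Lemma differentiable_mx_linear m n (W : normedModType K)
    (A : {linear 'M[K]_(m, n) -> W}) x : differentiable A x.
Proof. by case: (is_diff_mx_linear A x). Qed.

Lemma is_diff_near0 (V W : normedModType K) (f g df dg : V -> W) :
  (\forall v \near (0 : V), f v = g v) -> is_diff (0 : V) f df ->
  is_diff (0 : V) g dg -> df = dg.
Proof.
move=> /near_rnorm[e e0 fg] fd gd.
pose z : {linear V -> W} := \0.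
have f0 : is_diff (0 : V) (f - g) z.
  apply: (quadratic_remainder_diff (k := 0) (k' := 0) e0) => v.
    by rewrite rnorm0 mul0r.
  move=> ve; rewrite !fctE addr0 /= !fg ?rnorm0 // !subrr ?subr0 rnorm0.
  by rewrite mul0r.
have h : (z : V -> W) = df - dg.
  have f1 : is_diff (0 : V) (f - g) (df - dg) by exact: is_diffB.
  by case: f0 f1 => _ <- [_ <-].
apply/funext => v; apply/eqP; rewrite -subr_eq0; apply/eqP.
by move/(congr1 (fun F => F v)): h.
Qed.

Section Mulmx.
Variables m n p : nat.
Local Notation A := 'M[K]_(m, n).
Local Notation B := 'M[K]_(n, p).

Lemma is_diff_mulmx_pair (x : ((A * B)%type : normedModType K)) :
  is_diff x (fun q => q.1 *m q.2) (fun q => x.1 *m q.2 + q.1 *m x.2).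
Proof.
pose d (q : A * B) := x.1 *m q.2 + q.1 *m x.2.
have d_linear : linear d.
  move=> a u v; rewrite /d /= mulmxDr mulmxDl -scalemxAr -scalemxAl scalerDr.
  by rewrite addrACA.
pose dd : {linear (A * B)%type -> 'M[K]_(m, p)} :=
  HB.pack d (GRing.isLinear.Build _ _ _ _ _ d_linear).
apply: (@quadratic_remainder_diff _ _ _ _ x dd n%:R
  (n%:R * (rnorm x.1 + rnorm x.2)) 1 ltr01).
- move=> [u v] /=; rewrite /d /= rnorm_pair.
  apply: (le_trans (ler_rnormD _ _)).
  rewrite -mulrA mulrDl mulrDr lerD //; apply: (le_trans (rnorm_mulmx _ _)).
    by rewrite ler_wpM2l // ler_wpM2l ?rnorm_ge0 // le_max lexx orbT.
  rewrite ler_wpM2l // mulrC ler_wpM2l ?rnorm_ge0 //.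
  by rewrite le_max lexx.
- move=> [u v] _ /=; rewrite /d /= rnorm_pair.
  have -> : (u + x.1) *m (v + x.2) - x.1 *m x.2 - (x.1 *m v + u *m x.2) = u *m v.
    rewrite mulmxDl !mulmxDr !addrA opprD !addrA.
    by rewrite [LHS](ACl (1*(4*5)*(3*6)*(2*7))) /= !subrr !addr0.
  apply: (le_trans (rnorm_mulmx _ _)); rewrite ler_wpM2l // expr2.
  by rewrite ler_pM ?rnorm_ge0 // le_max lexx ?orbT.
Qed.

Lemma is_diff_mulmx (V : normedModType K) (f df : V -> A) (g dg : V -> B) x :
  is_diff x f df -> is_diff x g dg ->
  is_diff x (fun y => f y *m g y) (fun y => f x *m dg y + df y *m g x).
Proof.
move=> fd gd; have := is_diff_mulmx_pair (f x, g x).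
exact: (@is_diff_comp _ V (A * B)%type 'M[K]_(m, p)
  (fun y => (f y, g y)) (fun y => (df y, dg y)) _ _ x).
Qed.

End Mulmx.

(** A vector v killed by 1 + X satisfies v = - v X, which is too short unless
    v = 0. *)
Lemma unitmx_near1 m (X : 'M[K]_m) : m%:R * rnorm X < 1 -> 1%:M + X \in unitmx.
Proof.
move=> X1; rewrite -row_free_unit -kermx_eq0; apply/eqP/row_matrixP => i.
rewrite row0; set v := row i _; apply: rnorm0_eq0.
have : v *m (1%:M + X) = 0 by rewrite -row_mul mulmx_ker row0.
rewrite mulmxDr mulmx1 => /eqP; rewrite addr_eq0 => /eqP vE.
have := rnorm_mulmx v X; rewrite -[X in X <= _]rnormN -vE mulrCA => h.
by have := rnorm_ge0 v; nra.
Qed.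

End Calculus.

(** * The transversality principle *)

Lemma transport_sum (V : zmodType) (a b p e g q c : V) :
  a - b + p = e + (g - q) -> c + p + (a + q) = c + e + (b + g).
Proof.
move=> h; transitivity (c + (a - b + p) + (b + q)).
  by rewrite !addrA [RHS](ACl (1*4*2*6*(3*5))) /= addNr addr0.
by rewrite h !addrA [LHS](ACl (1*2*5*3*(4*6))) /= addNr addr0.
Qed.

(** ** Transversality and miniversality *)

Section Transversality.
Local Open Scope classical_set_scope.
Local Open Scope complex_scope.
Variable R : realType.
Local Notation K := R[i].
Variables m n : nat.
Variables (C : 'M[K]_(m, n)) (D : 'M[K]_(n, m)).
Variables (k : nat) (f : 'I_k -> entry m n).

Lemma param_pairE a : param_pair C D f a = (C + paramA f a, D + paramB f a).
Proof. by congr pair; apply/matrixP => i j; rewrite !mxE. Qed.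

Lemma param_pair_deformation : deformation C D (param_pair C D f).
Proof.
split; last first.
  by rewrite param_pairE !linear0 !addr0.
apply: filterE => a.
have -> : param_pair C D f = fun a => (C + paramA f a, D + paramB f a).
  by apply/funext => b; rewrite param_pairE.
pose pA : {linear 'rV[K]_k -> 'M[K]_(m, n)} := paramA f.
pose pB : {linear 'rV[K]_k -> 'M[K]_(n, m)} := paramB f.
have dA := differentiable_mx_linear pA a.
have dB := differentiable_mx_linear pB a.
apply: differentiable_pair; apply: differentiableD.
- exact: differentiable_cst.
- exact: dA.
- exact: differentiable_cst.
- exact: dB.
Qed.

Section Versal.
Hypothesis span : spanning C D f.

Let N := (m * n + n * m)%N.

Definition vec (E : 'M[K]_(m, n) * 'M[K]_(n, m)) : 'rV[K]_N :=
  row_mx (mxvec E.1) (mxvec E.2).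
Definition unvec (v : 'rV[K]_N) : 'M[K]_(m, n) * 'M[K]_(n, m) :=
  (vec_mx (lsubmx v), vec_mx (rsubmx v)).

Lemma vecK : cancel vec unvec.
Proof. by case=> A B; rewrite /vec /unvec row_mxKl row_mxKr !mxvecK. Qed.

Fact vec_linear : linear vec.
Proof.
move=> a u v; rewrite /vec /= !linearP /=.
by rewrite scale_row_mx add_row_mx.
Qed.
HB.instance Definition _ := GRing.isLinear.Build _ _ _ _ vec vec_linear.

Fact unvec_linear : linear unvec.
Proof. by move=> a u v; rewrite /unvec !linearP. Qed.
HB.instance Definition _ := GRing.isLinear.Build _ _ _ _ unvec unvec_linear.

Lemma rnorm_vec E : rnorm (vec E) <= rnorm E.
Proof.
case: E => A B; apply: rnorm_mx_le => [|i j]; first exact: rnorm_ge0.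
rewrite rnorm_pair le_max ord1 mxE.
case: (fintype.split j) => h /=; case/mxvec_indexP: h => i' j'; rewrite mxvecE.
  by apply/orP; left; exact: rnorm_entry.
by apply/orP; right; exact: rnorm_entry.
Qed.

(** The decomposition can be chosen linear in the decomposed pair: choose it on a
    basis. *)
Lemma linear_right_inverse : exists (X : {linear 'rV[K]_N -> 'M[K]_m})
    (Y : {linear 'rV[K]_N -> 'M[K]_n}) (h : {linear 'rV[K]_N -> 'rV[K]_k}),
  forall v, unvec v = (X v *m C - C *m Y v + paramA f (h v),
                       Y v *m D - D *m X v + paramB f (h v)).
Proof.
pose e j : 'rV[K]_N := delta_mx 0 j.
have /choice[X /choice[Y /choice[h XYh]]] :
    forall j, exists X Y h, unvec (e j) =
      (X *m C - C *m Y + paramA f h, Y *m D - D *m X + paramB f h).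
  by move=> j; exact: span.
pose comb (W : lmodType K) (w : 'I_N -> W) (v : 'rV[K]_N) := \sum_j v 0 j *: w j.
have comb_linear W w : linear (@comb W w).
  move=> a u v; rewrite /comb scaler_sumr -big_split /=.
  by apply: eq_bigr => j _; rewrite !mxE scalerDl scalerA.
pose lin (W : lmodType K) w : {linear 'rV[K]_N -> W} :=
  HB.pack (@comb W w) (GRing.isLinear.Build _ _ _ _ _ (comb_linear W w)).
exists (lin _ X), (lin _ Y), (lin _ h) => v.
have vE : unvec v = \sum_j v 0 j *: unvec (e j).
  by rewrite {1}[v]row_sum_delta linear_sum; apply: eq_bigr => j _; rewrite linearZ.
have sum1 (F : 'I_N -> 'M[K]_(m, n) * 'M[K]_(n, m)) :
    \sum_j F j = (\sum_j (F j).1, \sum_j (F j).2).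
  by apply: (big_rec3 (fun x y z => z = (x, y))) => // j x y z _ ->; case: (F j).
rewrite vE sum1 /= /comb !mulmx_suml !mulmx_sumr !linear_sum /=.
rewrite -!big_split /=.
congr pair; apply: eq_bigr => j _.
  have /= -> := congr1 fst (XYh j).
  by rewrite !linearZ /= !scalerDr scalerN -!scalemxAl.
have /= -> := congr1 snd (XYh j).
by rewrite !linearZ /= !scalerDr scalerN -!scalemxAl.
Qed.

(** With S = 1 + X and T = 1 + Y, the equations S (C + P) = (C + E1) T and
    T (D + Q) = (D + E2) S read
      (X C - C Y + P, Y D - D X + Q) = E + (E1 Y - X P, E2 X - Y Q).
    Taking for the unknown the left-hand side v, of which X, Y and the
    parameters are linear functions, this becomes the quadratic equation
    v = E + G ((E, v), v). *)
Lemma spanning_versal : versal C D (param_pair C D f).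
Proof.
split; first exact: param_pair_deformation.
have [X [Y [h XYh]]] := linear_right_inverse.
pose G (p : 'rV[K]_N * 'rV[K]_N) (v : 'rV[K]_N) : 'rV[K]_N :=
  vec ((unvec p.1).1 *m Y v - X v *m paramA f (h p.2),
       (unvec p.1).2 *m X v - Y v *m paramB f (h p.2)).
have G_bilin : bilinear_for *:%R *:%R G.
  split=> [v|p] a u w; rewrite /G; apply: (etrans _ (vec_linear _ _ _));
    congr vec; congr pair;
    rewrite /= !linearP /= ?mulmxDl ?mulmxDr -?scalemxAl -?scalemxAr;
    by rewrite !scalerDr !scalerN ?opprD addrACA.
(* A bound for G: all the linear maps in it are bounded by the same c. *)
pose GG : {bilinear 'rV[K]_N * 'rV[K]_N -> 'rV[K]_N -> 'rV[K]_N} :=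
  HB.pack G (bilinear_isBilinear.Build _ _ _ _ _ _ G G_bilin).
pose P : {linear 'rV[K]_N -> 'M[K]_(m, n)} := paramA f \o h.
pose Q : {linear 'rV[K]_N -> 'M[K]_(n, m)} := paramB f \o h.
have [cU cU0 Ub] := linear_mx_bounded unvec.
have [cX cX0 Xb] := linear_mx_bounded X.
have [cY cY0 Yb] := linear_mx_bounded Y.
have [cP cP0 Pb] := linear_mx_bounded P.
have [cQ cQ0 Qb] := linear_mx_bounded Q.
pose c := cU + cX + cY + cP + cQ.
have c0 : 0 <= c by rewrite /c; lra.
have le_c (x d t : R) : x <= d * t -> d <= c -> 0 <= t -> x <= c * t.
  by move=> xd dc t0; apply: (le_trans xd); rewrite ler_wpM2r.
have mul_le a1 a2 a3 (M1 : 'M[K]_(a1, a2)) (M2 : 'M[K]_(a2, a3)) s t :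
    (a2 <= m + n)%N -> rnorm M1 <= c * s -> rnorm M2 <= c * t ->
    0 <= s -> 0 <= t -> rnorm (M1 *m M2) <= (m + n)%:R * c ^+ 2 * (s * t).
  move=> a2mn M1s M2t s0 t0; apply: (le_trans (rnorm_mulmx _ _)).
  rewrite -mulrA ler_pM ?ler_nat ?mulr_ge0 ?rnorm_ge0 //.
  have -> : c ^+ 2 * (s * t) = (c * s) * (c * t) by ring.
  by rewrite ler_pM ?rnorm_ge0.
have Gb p v : rnorm (GG p v) <= 2 * ((m + n)%:R * c ^+ 2) * (rnorm p * rnorm v).
  case: p => e w; have := rnorm_ge0 v; have := rnorm_ge0 e; have := rnorm_ge0 w.
  move=> w0 e0 v0; apply: (le_trans (rnorm_vec _)).
  set p := rnorm (e, w).
  have [ep wp] : rnorm e <= p /\ rnorm w <= p.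
    by rewrite /p rnorm_pair !le_max !lexx orbT.
  have [U1 U2] : rnorm (unvec e).1 <= cU * p /\ rnorm (unvec e).2 <= cU * p.
    have : rnorm (unvec e) <= cU * p.
      by apply: (le_trans (Ub e)); rewrite ler_wpM2l.
    by rewrite [unvec e]surjective_pairing rnorm_pair ge_max => /andP.
  have Pw : rnorm (P w) <= cP * p by apply: (le_trans (Pb w)); rewrite ler_wpM2l.
  have Qw : rnorm (Q w) <= cQ * p by apply: (le_trans (Qb w)); rewrite ler_wpM2l.
  have p0 : 0 <= p by apply: rnorm_ge0.
  have [cUc cXc cYc cPc cQc] : [/\ cU <= c, cX <= c, cY <= c, cP <= c & cQ <= c].
    by rewrite /c; clear -cU0 cX0 cY0 cP0 cQ0; split; lra.
  have le2 a1 a2 (x y : 'M[K]_(a1, a2)) (z : R) :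
      rnorm x <= z -> rnorm y <= z -> rnorm (x - y) <= 2 * z.
    move=> xz yz; apply: (le_trans (ler_rnormD _ _)).
    by rewrite rnormN mulr2n mulrDl mul1r lerD.
  rewrite -[leRHS]mulrA rnorm_pair ge_max; apply/andP; split;
    apply: le2.
  - exact: (mul_le _ _ _ _ _ _ _ (leq_addl _ _) (le_c _ _ _ U1 cUc p0)
      (le_c _ _ _ (Yb v) cYc v0) p0 v0).
  - rewrite [p * _]mulrC.
    exact: (mul_le _ _ _ _ _ _ _ (leq_addr _ _) (le_c _ _ _ (Xb v) cXc v0)
      (le_c _ _ _ Pw cPc p0) v0 p0).
  - exact: (mul_le _ _ _ _ _ _ _ (leq_addr _ _) (le_c _ _ _ U2 cUc p0)
      (le_c _ _ _ (Xb v) cXc v0) p0 v0).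
  - rewrite [p * _]mulrC.
    exact: (mul_le _ _ _ _ _ _ _ (leq_addl _ _) (le_c _ _ _ (Yb v) cYc v0)
      (le_c _ _ _ Qw cQc p0) v0 p0).
have b0 : 0 <= 2 * ((m + n)%:R * c ^+ 2) by rewrite !mulr_ge0 ?exprn_ge0.
have [g [g0 g_hol gE]] := quadratic_implicit b0 Gb.
have near_vec (A : 'rV[K]_N -> Prop) :
    (\forall v \near (0 : ('rV[K]_N : normedModType K)), A v) ->
    \forall E \near (0 : (('M[K]_(m, n) * 'M[K]_(n, m))%type : normedModType K)),
      A (vec E).
  move=> /near_rnorm[e e0 eA]; apply: (rnorm_near e0) => E Ee; apply: eA.
  exact: le_lt_trans (rnorm_vec E) Ee.
have hol (W : normedModType K) (u : {linear 'rV[K]_N -> W}) (w : W) :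
    holomorphic_at0 (fun E => w + u (g (vec E))).
  apply: filterS (near_vec _ g_hol) => E gE'; apply: differentiableD => //.
  have [c1 _ uc1] := linear_mx_bounded u.
  have vec1 v : rnorm (vec v) <= 1 * rnorm v by rewrite mul1r rnorm_vec.
  apply: (@differentiable_comp _ _ _ _ (g \o vec) u).
    apply: (@differentiable_comp _ _ _ _ vec g); last exact: gE'.
    by have [] := bounded_linear_diff E vec1.
  by have [] := bounded_linear_diff (g (vec E)) uc1.
have unit_near a (u : {linear 'rV[K]_N -> 'M[K]_a}) :
    \forall E \near (0 : (('M[K]_(m, n) * 'M[K]_(n, m))%type : normedModType K)),
      1%:M + u (g (vec E)) \in unitmx.
  have /differentiable_continuous := nbhs_singleton (hol _ u 0).
  rewrite /prop_for /continuous_at /= linear0 g0 linear0 addr0 => /cvgr0_norm_lt.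
  have e0 : 0 < ((a%:R + 1 : R)^-1)%:C :> K by rewrite ltcR invr_gt0 ltr_wpDl.
  move=> /(_ _ e0); apply: filterS => E; rewrite add0r rnormE ltcR => ue.
  apply: unitmx_near1; move: ue; rewrite -[X in _ < X]mul1r ltr_pdivlMr ?ltr_wpDl //.
  by apply: le_lt_trans; rewrite mulrC ler_wpM2l ?rnorm_ge0 // lerDl.
exists (h \o g \o vec), (fun E => 1%:M + X (g (vec E))),
  (fun E => 1%:M + Y (g (vec E))).
split; first split; [|exact: hol|exact: hol|].
  by have := hol _ h 0; congr holomorphic_at0; apply/funext => E; rewrite add0r.
split; first by rewrite /= linear0 g0 !linear0 !addr0.
have := near_vec _ gE; have := unit_near _ X; have := unit_near _ Y.
apply: filterS3 => E YU XU fE; split=> //.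
rewrite param_pairE /=; move: fE => /(congr1 unvec).
have unvecD a b : unvec (a + b) = unvec a + unvec b by exact: linearD.
rewrite unvecD vecK /= /G vecK XYh vecK => fE.
have /= f1 := congr1 fst fE; have /= f2 := congr1 snd fE.
move: (g (vec E)) XU YU f1 f2 => v XU YU f1 f2.
congr pair; rewrite -mulmxA.
  apply: (canRL (mulKmx XU)).
  rewrite mulmxDl mul1mx !mulmxDr mulmx1 mulmxDl; exact: transport_sum.
apply: (canRL (mulKmx YU)).
rewrite mulmxDl mul1mx !mulmxDr mulmx1 mulmxDl; exact: transport_sum.
Qed.

End Versal.
Section Minimal.
Hypothesis indep : independent C D f.

(** Differentiating S CD(h E) = (C + E1) T at 0 shows that E is tangent to the
    orbit as soon as the derivative of h kills E.  So the derivative of h is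
    injective on the star directions, which are independent modulo the tangent
    space: h takes values in a space of dimension at least k. *)
Lemma independent_minimal k' (CD : 'rV[K]_k' -> 'M[K]_(m, n) * 'M[K]_(n, m)) :
  versal C D CD -> (k <= k')%N.
Proof.
move=> [[CD_hol CD0] [h [S [T [[h_hol S_hol T_hol] [[h0 S0 T0] ST]]]]]].
pose W := ('M[K]_(m, n) * 'M[K]_(n, m))%type.
have Sd := differentiableP (nbhs_singleton S_hol).
have Td := differentiableP (nbhs_singleton T_hol).
have hd := differentiableP (nbhs_singleton h_hol).
have CDd : is_diff (h 0) CD ('d CD 0).
  by rewrite h0; exact: differentiableP (nbhs_singleton CD_hol).
pose dh := 'd h (0 : (W : normedModType K)).
pose dCD := 'd CD (0 : ('rV[K]_k' : normedModType K)).
have CDhd := is_diff_comp hd CDd.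
have CD1 := is_diff_comp CDhd (is_diff_fst (CD (h 0))).
have CD2 := is_diff_comp CDhd (is_diff_snd (CD (h 0))).
have E1 := is_diffD (is_diff_cst C (0 : (W : normedModType K))) (is_diff_fst (0 : W)).
have E2 := is_diffD (is_diff_cst D (0 : (W : normedModType K))) (is_diff_snd (0 : W)).
have L1 := is_diff_mulmx Sd CD1.
have L2 := is_diff_mulmx Td CD2.
have R1 := is_diff_mulmx E1 Td.
have R2 := is_diff_mulmx E2 Sd.
have eq1 e : S 0 *m (dCD (dh e)).1 + 'd S 0 e *m (CD (h 0)).1 =
    (C + 0) *m 'd T 0 e + (0 + e.1) *m T 0.
  have := is_diff_near0 _ L1 R1 => /(_ _)/(congr1 (fun F => F e)); apply.
  apply: filterS ST => E [SU TU] /= ->.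
  by rewrite /= -mulmxA mulKVmx.
have eq2 e : T 0 *m (dCD (dh e)).2 + 'd T 0 e *m (CD (h 0)).2 =
    (D + 0) *m 'd S 0 e + (0 + e.2) *m S 0.
  have := is_diff_near0 _ L2 R2 => /(_ _)/(congr1 (fun F => F e)); apply.
  apply: filterS ST => E [SU TU] /= ->.
  by rewrite /= -mulmxA mulKVmx.
pose par (a : 'rV[K]_k) : W := (paramA f a, paramB f a).
have par_linear : linear (dh \o par).
  move=> a u v /=; have -> : par (a *: u + v) = a *: par u + par v.
    by rewrite /par !linearP.
  by rewrite linearP.
pose F : {linear 'rV[K]_k -> 'rV[K]_k'} :=
  HB.pack (dh \o par) (GRing.isLinear.Build _ _ _ _ _ par_linear).
have F_inj a : F a = 0 -> a = 0.
  rewrite /F /= => a0; have := eq1 (par a); have := eq2 (par a).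
  rewrite a0 linear0 /= h0 CD0 S0 T0 /= !mulmx0 !addr0 !add0r !mulmx1 => e2 e1.
  by apply: (indep (X := 'd S 0 (par a)) (Y := 'd T 0 (par a)));
    rewrite ?e1 ?e2 addrC addKr.
have : row_free (lin1_mx F).
  rewrite -kermx_eq0; apply/eqP/row_matrixP => i; rewrite row0; apply: F_inj.
  by rewrite -mul_rV_lin1 -row_mul mulmx_ker row0.
by rewrite -row_leq_rank => /leq_trans; apply; exact: rank_leq_col.
Qed.
End Minimal.

Lemma transversal_miniversal : spanning C D f -> independent C D f ->
  miniversal C D (param_pair C D f).
Proof.
by move=> span indep; split; [exact: spanning_versal|exact: independent_minimal].
Qed.

Lemma param_pair_simple : injective f ->
  simple_deformation C D (param_pair C D f).
Proof.
by move=> f_inj; split; [exact: param_pair_deformation|exists f => //; exact: filterE].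
Qed.

End Transversality.

(** * The deformation of the canonical pair *)

Section Main.
Variables (R : realType).
Local Notation K := R[i].
Variables (tau : nat) (lambda : 'I_tau -> K).
Variables (t : 'I_tau -> nat) (n : forall a : 'I_tau, 'I_(t a) -> nat).
Variables (l : nat) (p : 'I_l -> nat) (t0 : nat) (n0 : 'I_t0 -> nat).
Variables (t1 : nat) (n1 : 'I_t1 -> nat) (r : nat) (q : 'I_r -> nat).
Hypothesis lambda_inj : injective lambda.
Hypothesis lambda_neq0 : forall a, lambda a != 0.
Hypothesis p_gt0 : forall i, (0 < p i)%N.
Hypothesis p_noninc : forall i j : 'I_l, (i <= j)%N -> (p j <= p i)%N.
Hypothesis q_gt0 : forall i, (0 < q i)%N.
Hypothesis q_nondec : forall i j : 'I_r, (i <= j)%N -> (q i <= q j)%N.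

Let C := block_mx (1%:M : 'M[K]_(\sum_a \sum_i @n a i)) 0 0 (canA K p n0 n1 q).
Let D := block_mx (Jfull n lambda) 0 0 (canB K p n0 n1 q).
Let P := block_mx (0 : 'M[bool]_(\sum_a \sum_i @n a i)) 0 0 (starsA p n0 n1 q).
Let Q := block_mx (starsK n) 0 0 (starsB p n0 n1 q).

Local Notation summand := (summand t l t0 t1 r).
Local Notation nrows := (@nrows tau t n l p t0 n0 t1 n1 r q).
Local Notation ncols := (@ncols tau t n l p t0 n0 t1 n1 r q).
Local Notation len := (@size_summand tau t n l p t0 n0 t1 n1 r q).
Local Notation row_coord := (@row_coord tau t n l p t0 n0 t1 n1 r q).
Local Notation col_coord := (@col_coord tau t n l p t0 n0 t1 n1 r q).
Local Notation starA := (@starA tau t n l p t0 n0 t1 n1 r q).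
Local Notation starB := (@starB tau t n l p t0 n0 t1 n1 r q).
Local Notation lam := (@eigenvalue_of K tau lambda t l t0 t1 r).

Let Nr := (\sum_a \sum_i @n a i +
  ((\sum_i p i + \sum_i n0 i) + (\sum_i n1 i + \sum_i (q i).-1)))%N.
Let Nc := (\sum_a \sum_i @n a i +
  ((\sum_i (p i).-1 + \sum_i n0 i) + (\sum_i n1 i + \sum_i q i)))%N.

(* The chains of the canonical pair are its summands. *)
Let blk (v : 'I_Nr + 'I_Nc) : summand :=
  match v with inl i => (row_coord i).1 | inr j => (col_coord j).1 end.
Let pos (v : 'I_Nr + 'I_Nc) : nat :=
  match v with inl i => row_pos (row_coord i) | inr j => col_pos (col_coord j) end.

Lemma row_pos_lt (x : summand * nat) : (x.2 < nrows x.1 -> row_pos x < len x.1)%N.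
Proof.
case: x => [[s|[[i|i]|[i|i]]] k]; rewrite /row_pos /size_summand /=; lia.
Qed.

Lemma col_pos_lt (x : summand * nat) : (x.2 < ncols x.1 -> col_pos x < len x.1)%N.
Proof.
case: x => [[s|[[i|i]|[i|i]]] k]; rewrite /col_pos /size_summand /=; lia.
Qed.

(** Every position of a chain is taken, by a row or by a column according to its
    parity. *)
Lemma pos_half (b : summand) k : (k < len b)%N ->
  if odd k == col_first b then (k./2 < nrows b)%N /\ row_pos (b, k./2) = k
  else (k./2 < ncols b)%N /\ col_pos (b, k./2) = k.
Proof.
rewrite /row_pos /col_pos /size_summand.
case: b => [s|[[i|i]|[i|i]]] /=; (try have := p_gt0 i); (try have := q_gt0 i);
  by case: (boolP (odd k)) => /= ok; lia.
Qed.

Let pos_lt v : (pos v < len (blk v))%N.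
Proof.
have [rd _ _] := row_coordinates n p n0 n1 q.
have [cd _ _] := col_coordinates n p n0 n1 q.
by case: v => [i|j]; [apply: row_pos_lt; exact: rd|apply: col_pos_lt; exact: cd].
Qed.

Let pos_odd v : odd (pos v) = is_col v (+) col_first (blk v).
Proof.
by case: v => [i|j] /=; rewrite /row_pos /col_pos oddD odd_double /=; case: col_first.
Qed.

Let pair_inj (x y : summand * nat) : x.1 = y.1 -> x.2 = y.2 -> x = y.
Proof. by case: x y => [a b] [c d] /= -> ->. Qed.

Let pos_inj u v : blk u = blk v -> pos u = pos v -> u = v.
Proof.
have [_ rinj _] := row_coordinates n p n0 n1 q.
have [_ cinj _] := col_coordinates n p n0 n1 q.
move=> e e'; have : is_col u = is_col v.
  have := pos_odd u; have := pos_odd v; rewrite e e' => ->.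
  by do 2!case: is_col; case: col_first.
case: u v e e' => [i|j] [i'|j'] //= e e' _; congr (_ _).
  apply: rinj; apply: pair_inj => //; move: e'; rewrite /row_pos e.
  by case: col_first; lia.
apply: cinj; apply: pair_inj => //; move: e'; rewrite /col_pos e.
by case: col_first; lia.
Qed.

Let pos_surj b k : (k < len b)%N -> exists2 v, blk v = b & pos v = k.
Proof.
have [_ _ rsurj] := row_coordinates n p n0 n1 q.
have [_ _ csurj] := col_coordinates n p n0 n1 q.
move=> /pos_half; case: ifP => _ [kb e].
  by have [i iE] := rsurj _ _ kb; exists (inl i); rewrite /= iE.
by have [i iE] := csurj _ _ kb; exists (inr i); rewrite /= iE.
Qed.

Let lam_even b : lam b != 0 -> ~~ col_first b /\ ~~ odd (len b).
Proof.
by case: b => [s|b] /=; rewrite ?eqxx // /size_summand /= addnn odd_double.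
Qed.

Let C_arrow i j : C i j = (arrow blk pos (inl i) (inr j))%:R.
Proof. exact: canonical_C. Qed.

Let D_arrow j i : D j i = (arrow blk pos (inr j) (inl i))%:R +
  (arrow blk pos (inl i) (inr j))%:R * lam (blk (inl i)).
Proof. exact: canonical_D. Qed.

Let f (s : 'I_#|stars P Q|) : entry Nr Nc := enum_val s.

Let f_star s : match f s with
  | inl ij => starA (row_coord ij.1) (col_coord ij.2)
  | inr ji => starB (col_coord ji.1) (row_coord ji.2) end.
Proof.
have := enum_valP s; rewrite /f inE; case: (enum_val s) => -[i j] /=.
  by rewrite (@stars_A tau t n l p t0 n0 t1 n1 r q i j).
by rewrite (@stars_B tau t n l p t0 n0 t1 n1 r q i j).
Qed.

Let star_f (x : entry Nr Nc) : match x with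
  | inl ij => starA (row_coord ij.1) (col_coord ij.2)
  | inr ji => starB (col_coord ji.1) (row_coord ji.2) end -> exists s, f s = x.
Proof.
move=> sx; have xs : x \in stars P Q.
  rewrite inE; case: x sx => -[i j] /=.
    by rewrite (@stars_A tau t n l p t0 n0 t1 n1 r q i j).
  by rewrite (@stars_B tau t n l p t0 n0 t1 n1 r q i j).
by exists (enum_rank_in xs x); rewrite /f enum_rankK_in.
Qed.

Lemma starA_lam x y : starA x y -> lam x.1 = 0 /\ lam y.1 = 0.
Proof.
by case: x y => [[s|[[i|i]|[i|i]]] k] [[s'|[[j|j]|[j|j]]] k'].
Qed.

Lemma starB_lam y x : starB y x -> lam y.1 = lam x.1.
Proof.
case: x y => [[s|[[i|i]|[i|i]]] k] [[s'|[[j|j]|[j|j]]] k'] //.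
by rewrite /starB /=; case: eqP => [e _|]; [rewrite e|].
Qed.

Let f_lam s : lam (blk (source (f s))) = lam (blk (target (f s))).
Proof.
have := f_star s; case: (f s) => -[i j] /=; first by move=> /starA_lam[-> ->].
exact: starB_lam.
Qed.

Let f_allowed s : allowed len blk pos (source (f s)) (target (f s)).
Proof.
have [rd _ _] := row_coordinates n p n0 n1 q.
have [cd _ _] := col_coordinates n p n0 n1 q.
have := f_star s; case: (f s) => -[i j] /= st; apply/andP.
  exact: (starA_allowed p_noninc q_nondec (rd i) (cd j) st).
exact: (starB_allowed p_noninc q_nondec (cd i) (rd j) st).
Qed.

Let f_col s : lam (blk (target (f s))) != 0 -> is_col (source (f s)).
Proof.
have := f_star s; case: (f s) => -[i j] //= /starA_lam[_ ->].
by rewrite eqxx.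
Qed.

Let f_uniq s s' : blk (source (f s)) = blk (source (f s')) ->
  blk (target (f s)) = blk (target (f s')) ->
  (pos (target (f s)) + pos (source (f s')) =
     pos (source (f s)) + pos (target (f s')))%N ->
  s = s'.
Proof.
have [rd rinj _] := row_coordinates n p n0 n1 q.
have [cd cinj _] := col_coordinates n p n0 n1 q.
move=> bs bt e; apply: enum_val_inj; move: bs bt e; rewrite -/(f s) -/(f s').
have := f_star s; have := f_star s'.
case: (f s) (f s') => -[i j] [] [i' j'] /= st' st bs bt e.
- have [likeA _] := star_like_shape (row_coord i).1 (col_coord j).1.
  move: st' (rd i') (cd j'); rewrite /starA -bs -bt => st' ri' cj'.
  have [|ek ek'] := likeA _ _ _ _ _ _ (rd i) ri' (cd j) cj' st st'.
    move: e; rewrite /row_pos /col_pos -bs -bt; do 2!case: col_first => /=; lia.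
  by congr (inl (_, _)); [apply: rinj|apply: cinj]; apply: pair_inj.
- by move: st st'; rewrite /starA /starB bs bt => st /(shape_exclusive st).
- by move: st st'; rewrite /starA /starB bs bt => st /shape_exclusive/(_ st).
- have [_ likeB] := star_like_shape (col_coord i).1 (row_coord j).1.
  move: st' (cd i') (rd j'); rewrite /starB -bs -bt => st' ci' rj'.
  have [|ek ek'] := likeB _ _ _ _ _ _ (cd i) ci' (rd j) rj' st st'.
    move: e; rewrite /row_pos /col_pos -bs -bt; do 2!case: col_first => /=; lia.
  by congr (inr (_, _)); [apply: cinj|apply: rinj]; apply: pair_inj.
Qed.

Let f_ex x : lam (blk (source x)) = lam (blk (target x)) ->
  (lam (blk (target x)) != 0 -> is_col (source x)) ->
  allowed len blk pos (source x) (target x) ->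
  exists s, [/\ blk (source x) = blk (source (f s)),
    blk (target x) = blk (target (f s)) &
    (pos (source (f s)) + pos (target x) = pos (source x) + pos (target (f s)))%N].
Proof.
have [_ _ rsurj] := row_coordinates n p n0 n1 q.
have [_ _ csurj] := col_coordinates n p n0 n1 q.
have := pos_lt (source x); have := pos_lt (target x).
have := pos_odd (source x); have := pos_odd (target x).
have : is_col (source x) = ~~ is_col (target x) by case: (x) => -[].
move: (source x) (target x) => u v uv ov ou ltv ltu luv cu /andP[le1 le2].
have [||||||[k [k' [kb kb' st e]]]|[k [k' [kb kb' st e]]]] :=
  @shape_exists tau t n l p t0 n0 t1 n1 r q p_noninc q_nondec
  (blk u) (blk v) (pos u) (pos v).
- case eu : (blk u) luv cu => [s|b]; case ev : (blk v) => [s'|b'] //= luv cu.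
  + split; first exact: lambda_inj.
    by rewrite ou eu cu ?lambda_neq0.
  + by have := lambda_neq0 (tag s); rewrite luv eqxx.
  + by have := lambda_neq0 (tag s'); rewrite -luv eqxx.
- by rewrite oddD ou ov uv; case: is_col; do 2!case: col_first.
- exact: ltu.
- exact: ltv.
- exact: le1.
- exact: le2.
- have [i iE] := rsurj _ _ kb; have [j jE] := csurj _ _ kb'.
  have [|s fs] := @star_f (inl (i, j)); first by rewrite /= iE jE.
  by exists s; rewrite fs /= iE jE.
- have [j jE] := csurj _ _ kb; have [i iE] := rsurj _ _ kb'.
  have [|s fs] := @star_f (inr (j, i)); first by rewrite /= iE jE.
  by exists s; rewrite fs /= iE jE.
Qed.

Lemma canonical_spanning : spanning C D f.
Proof.
exact: (chains_spanning pos_lt pos_inj pos_surj pos_odd lam_even C_arrow D_arrow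
  f_col f_ex).
Qed.

Lemma canonical_independent : independent C D f.
Proof.
exact: (chains_independent pos_lt pos_inj pos_surj pos_odd lam_even C_arrow D_arrow
  f_lam f_allowed f_col f_uniq).
Qed.

Lemma canonical_miniversal :
  simple_deformation C D (star_deformation C D P Q) /\
  miniversal C D (star_deformation C D P Q).
Proof.
split; first by apply: param_pair_simple; exact: enum_val_inj.
apply: transversal_miniversal; [exact: canonical_spanning|exact: canonical_independent].
Qed.

End Main.

Theorem theorem4p1 (R : realType)
    (* the blocks J_{n a i}(lambda a) of the nonsingular Jordan matrix J *)
    (tau : nat) (lambda : 'I_tau -> R[i])
    (t : 'I_tau -> nat) (n : forall a : 'I_tau, 'I_(t a) -> nat)
    (lambda_inj : injective lambda)
    (lambda_neq0 : forall a, lambda a != 0)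
    (n_gt0 : forall a (i : 'I_(t a)), (0 < n a i)%N)
    (n_noninc : forall a (i j : 'I_(t a)), (i <= j)%N -> (n a j <= n a i)%N)
    (* the summands (F_{p i}, G_{p i}^T) *)
    (l : nat) (p : 'I_l -> nat)
    (p_gt0 : forall i, (0 < p i)%N)
    (p_noninc : forall i j : 'I_l, (i <= j)%N -> (p j <= p i)%N)
    (* the blocks of J(0) *)
    (t0 : nat) (n0 : 'I_t0 -> nat)
    (n0_gt0 : forall i, (0 < n0 i)%N)
    (n0_noninc : forall i j : 'I_t0, (i <= j)%N -> (n0 j <= n0 i)%N)
    (* the blocks of J'(0) *)
    (t1 : nat) (n1 : 'I_t1 -> nat)
    (n1_gt0 : forall i, (0 < n1 i)%N)
    (n1_noninc : forall i j : 'I_t1, (i <= j)%N -> (n1 j <= n1 i)%N)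
    (* the summands (G_{q i}^T, F_{q i}) *)
    (r : nat) (q : 'I_r -> nat)
    (q_gt0 : forall i, (0 < q i)%N)
    (q_nondec : forall i j : 'I_r, (i <= j)%N -> (q i <= q j)%N) :
  let C := block_mx 1%:M 0 0 (canA R[i] p n0 n1 q) in
  let D := block_mx (Jfull n lambda) 0 0 (canB R[i] p n0 n1 q) in
  let P := block_mx (0 : 'M[bool]_(\sum_a \sum_i n a i)) 0 0 (starsA p n0 n1 q) in
  let Q := block_mx (starsK n) 0 0 (starsB p n0 n1 q) in
  simple_deformation C D (star_deformation C D P Q) /\
  miniversal C D (star_deformation C D P Q).
Proof. exact: canonical_miniversal. Qed.
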